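(* Let $\partial,\theta_0,\theta_1$ be regular cardinals with $\partial > \theta_1 > \theta_0 \ge \aleph_0$, and let $\lambda = \partial^+$. Then $\Pr_1(\lambda,\lambda,\lambda,(\theta_0,\theta_1))$ holds.
   Context: For cardinals $\lambda \ge \mu \ge \sigma + \theta_0 + \theta_1$ and $\bar\theta = (\theta_0,\theta_1)$, $\Pr_1(\lambda,\mu,\sigma,\bar\theta)$ means: there is a function $\mathbf c : [\lambda]^2 \to \sigma$ such that whenever $\mathbf i_0 < \theta_0$ and $\mathbf i_1 < \theta_1$ are ordinals, for $\iota = 0,1$ the sequence $\bar\zeta^\iota = \langle \zeta^\iota_{\alpha,i} : \alpha < \mu, i < \mathbf i_\iota\rangle$ is a sequence without repetitions of ordinals $< \lambda$, the ranges of $\bar\zeta^0$ and $\bar\zeta^1$ are disjoint, and $\gamma < \sigma$, then there are $\alpha_0 < \alpha_1 < \mu$ such that $\mathbf c\{\zeta^0_{\alpha_0,i_0},\zeta^1_{\alpha_1,i_1}\} = \gamma$ for all $i_0 < \mathbf i_0$ and $i_1 < \mathbf i_1$. *)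

(* Defs.v *)
From mathcomp Require Import all_boot all_order.
From mathcomp Require Import boolp classical_sets functions cardinality wochoice.

Set Implicit Arguments.
Unset Strict Implicit.
Unset Printing Implicit Defensive.

Local Open Scope classical_set_scope.
Local Open Scope card_scope.
Local Open Scope order_scope.

(* A cardinal is an initial ordinal, presented as a well-ordered type that does
   not inject into any of its proper initial segments. As for von Neumann
   ordinals, the elements [b] of a cardinal [k] are the ordinals smaller than
   [k], and the ordinal [b] is itself the type of the elements below [b]. *)
Record cardinal := Cardinal {
  card_disp : Order.disp_t;
  card_sort :> orderType card_disp;
  card_wo : well_order (<=%O : rel card_sort);
  card_initial : forall b : card_sort,
    ~~ ([set: card_sort] #<= [set x : card_sort | x < b]) }.

Definition below (k : cardinal) (b : k) : Type := {x : k | x < b}.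

Definition cle (k l : cardinal) : Prop := [set: k] #<= [set: l].

Definition clt (k l : cardinal) : Prop := cle k l /\ ~ cle l k.

Definition aleph0_le (k : cardinal) : Prop := [set: nat] #<= [set: k].

Definition cofinal (k : cardinal) (A : set k) : Prop :=
  forall x : k, exists2 y, A y & x <= y.

(* cf(k) = k: the least cardinality of a cofinal subset of [k] is [k]. *)
Definition regular (k : cardinal) : Prop :=
  aleph0_le k /\ forall A : set k, cofinal A -> [set: k] #<= A.

Definition is_succ_card (d l : cardinal) : Prop :=
  clt d l /\ forall k : cardinal, clt d k -> cle l k.

(* [T]^2, the set of two-element subsets of T. *)
Definition upairs (T : Type) : Type :=
  {A : set T | exists x y, x <> y /\ A = [set x; y]}.

Definition upair (T : Type) (x y : T) (xy : x <> y) : upairs T :=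
  exist _ [set x; y] (ex_intro _ x (ex_intro _ y (conj xy erefl))).

(* [disj] says that the ranges of the two sequences are disjoint; it also
   ensures that the two points fed to the colouring are distinct. *)
Definition Pr1 (lam mu sig th0 th1 : cardinal) : Prop :=
  exists c : upairs lam -> sig,
  forall (b0 : th0) (b1 : th1)
         (z0 : mu * below b0 -> lam) (z1 : mu * below b1 -> lam),
    injective z0 -> injective z1 ->
    forall disj : (forall p0 p1, z0 p0 <> z1 p1),
    forall g : sig,
    exists a0 a1 : mu, a0 < a1 /\
      forall (i0 : below b0) (i1 : below b1),
        c (upair (disj (a0, i0) (a1, i1))) = g.

(* Main.v *)
From HB Require Import structures.
From mathcomp Require Import all_boot all_order.
From mathcomp Require Import boolp classical_sets functions cardinality wochoice.
Require Import Defs.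

Set Implicit Arguments.
Unset Strict Implicit.
Unset Printing Implicit Defensive.

Import Order.TTheory.
Local Open Scope classical_set_scope.
Local Open Scope card_scope.
Local Open Scope order_scope.

(** Fix injections [e b] of the ordinals below [b < lam] into [del], and walk
    from [b] down to [a] by always moving to the point of [[a, b)] of least
    index for [e b]. If [x] has cofinality [del], then the walks from fewer than
    [del] points above [x] to any [a < x] close enough to [x] all pass through
    [x]. Partition the points of cofinality [del] into stationary sets, so that
    each carries a tag [h] in [th1], a tag [k] in [K] := [th0]^+ and a colour
    [g] in [lam]. The colour of the pair [{a, b}] is [g x] for a node [x] of the
    walk, and the task is to recognise [x] from [a] and [b].

    The part of the walk near the points of the upper block is cut off by
    starting at the first node of maximal [h]; when a node of large [h] is
    inserted above [x], this node is the same for all pairs considered, and [x]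
    is [q] steps below it, for some [q]. To transmit [q], use a subadditive
    function [rho] from pairs of [K] to [th0], every [rho _ j] being
    less-than-[th0]-to-one. Insert nodes of [k]-tag [i] above [x] and of
    [k]-tag [j] below [x]. The tags met above do not depend on [j], nor those
    below on [i]; hence [i < j] can be chosen with [rho i j] above every value
    of [rho] met inside either side, and then [j] can be read off the sequence
    of [k]-tags: it is the least right end of the increasing pairs of maximal
    [rho] (with largest left end). By Fodor's lemma the tags below [x] that are
    less than [j] are bounded below [i], so that [j] is read off exactly, and it
    is chosen in a stationary subset of [K] labelled [q]. *)

(** * Cardinal arithmetic *)

(** The relation need not be single-valued, which avoids total functions and default values; choice
    recovers an injection. *)
Lemma card_leE (T U : Type) (A : set T) (B : set U) :
  (A #<= B) <-> exists r : T -> U -> Prop,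
    (forall x, A x -> exists2 y, B y & r x y) /\
    (forall x x' y, A x -> A x' -> r x y -> r x' y -> x = x').
Proof.
split.
  move=> /card_leP[f].
  exists (fun x y => exists p : A, \val p = x /\ \val (f p) = y); split.
    move=> x Ax; exists (\val (f (exist _ x (mem_set Ax)))); first exact: set_valP.
    by exists (exist _ x (mem_set Ax)).
  move=> x x' y _ _ [p [<- pe]] [p' [<- pe']].
  congr (\val _); apply: (@inj _ _ _ f); rewrite ?in_setT //.
  by apply: val_inj; rewrite pe pe'.
move=> [r [r1 r2]].
have /choice[f fP] : forall p : A, exists q : B, r (\val p) (\val q).
  move=> p; have [y By ry] := r1 _ (set_valP p).
  by exists (exist _ y (mem_set By)).
apply/card_leP/injfunPex; exists f => // p q _ _ fpq.
apply: val_inj; apply: (r2 _ _ (\val (f p))) => //; try exact: set_valP.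
by rewrite fpq; exact: fP.
Qed.

Section WellOrder.
Context {d : Order.disp_t} {T : orderType d}.
Hypothesis wo : well_order (<=%O : rel T).

Lemma wo_min (P : T -> Prop) : (exists x, P x) ->
  exists2 x, P x & forall y, P y -> x <= y.
Proof.
move=> [x Px].
have [|z [[zP zm] _]] := wo (A := [pred y | `[< P y >]]).
  by exists x; apply/asboolP.
exists z; first by apply/asboolP.
by move=> y Py; apply: zm; apply/asboolP.
Qed.

Lemma wo_wf : well_founded (fun x y : T => x < y).
Proof.
move=> x; apply: contrapT => nx.
have [z nz zm] := wo_min (ex_intro (fun x => ~ Acc _ x) _ nx).
apply: nz; constructor => y yz; apply: contrapT => ny.
by have := zm _ ny; rewrite leNgt yz.
Qed.

Lemma wo_ind (P : T -> Prop) :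
  (forall x, (forall y, y < x -> P y) -> P x) -> forall x, P x.
Proof. by move=> H x; elim: (wo_wf x) => {}x _ IH; apply: H. Qed.

End WellOrder.

Definition pickd (U : Type) (u0 : U) (P : U -> Prop) : U :=
  if pselect (exists u, P u) is left h then sval (cid h) else u0.

Lemma pickdP (U : Type) (u0 : U) (P : U -> Prop) :
  (exists u, P u) -> P (pickd u0 P).
Proof. by rewrite /pickd; case: pselect => // h _; exact: svalP (cid h). Qed.

Lemma greedy (P U : Type) (R : P -> P -> Prop) (A : set P) (D : set U) :
  well_founded R -> (forall p q, p = q \/ R p q \/ R q p) ->
  (forall p, A p -> ~ (D #<= [set q | A q /\ R q p])) -> A #<= D.
Proof.
move=> wfR tR H.
have [[p0 Ap0]|A0] := pselect (exists p, A p); last first.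
  by apply/card_leE; exists (fun _ _ => True); split=> [x Ax|x ? ? Ax]; case: A0; exists x.
have [u0 _] : exists u, D u.
  apply: contrapT => D0; apply: (H _ Ap0); apply/card_leE.
  by exists (fun _ _ => True); split=> [x Dx|x ? ? Dx]; case: D0; exists x.
pose f := Fix wfR (fun _ => U) (fun p rec =>
  pickd u0 (fun u => D u /\ forall q (h : R q p), A q -> rec q h <> u)).
have fE p : f p = pickd u0 (fun u => D u /\ forall q, R q p -> A q -> f q <> u).
  rewrite /f Fix_eq //= => x g g' gg'.
  suff -> : g = g' by [].
  apply: functional_extensionality_dep => y.
  by apply: functional_extensionality_dep => h; exact: gg'.
have fP p : A p -> D (f p) /\ forall q, R q p -> A q -> f q <> f p.
  move=> Ap; rewrite [f p]fE.
  apply: (@pickdP _ u0 (fun u => D u /\ forall q, R q p -> A q -> f q <> u)).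
  apply: contrapT => N.
  apply: (H _ Ap); apply/card_leE; exists (fun u q => f q = u); split.
    move=> u Du; apply: contrapT => Nq; apply: N; exists u; split=> // q Rq Aq fq.
    by apply: Nq; exists q.
  by move=> x x' q _ _ <- <-.
apply/card_leE; exists (fun p u => f p = u); split.
  by move=> p Ap; exists (f p) => //; case: (fP _ Ap).
move=> p q u Ap Aq fp fq; have [//|[Rpq|Rqp]] := tR p q.
  by case: ((fP _ Aq).2 _ Rpq Ap); rewrite fp fq.
by case: ((fP _ Ap).2 _ Rqp Aq); rewrite fp fq.
Qed.

Lemma card_le_sqr (T U : Type) (A : set T) (B : set U) :
  A #<= B -> A `*` A #<= B `*` B.
Proof.
move=> /card_leE[r [r1 r2]]; apply/card_leE.
exists (fun p q => r p.1 q.1 /\ r p.2 q.2); split.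
  move=> [x y] [/= Ax Ay]; have [x' ? ?] := r1 _ Ax; have [y' ? ?] := r1 _ Ay.
  by exists (x', y').
move=> [x y] [x' y'] [u v] [/= Ax Ay] [/= Ax' Ay'] [/= rx ry] [/= rx' ry'].
by congr pair; [exact: (r2 _ _ u)|exact: (r2 _ _ v)].
Qed.

(** Hilbert's hotel: [c] goes to [f 0], any other [f n] to [f n.+1], and the rest stays. *)
Lemma card_le_add1 (T : Type) (A : set T) (c : T) :
  [set: nat] #<= A -> c |` A #<= A.
Proof.
move=> /card_leE[r [r1 r2]].
have /choice[f fP] : forall n, exists y, A y /\ r n y.
  by move=> n; have [y Ay rny] := r1 n I; exists y.
have fI : injective f.
  move=> m n mn; apply: (r2 _ _ (f n)) => //; last by case: (fP n).
  by rewrite -mn; case: (fP m).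
apply/card_leE; exists (fun x y => (x = c /\ y = f 0%N) \/
  x <> c /\ ((exists2 n, x = f n & y = f n.+1) \/
  ((forall n, x <> f n) /\ y = x))); split.
  move=> x Ax; have [->|xc] := pselect (x = c).
    by exists (f 0%N); [case: (fP 0%N)|left].
  have {}Ax : A x by case: Ax.
  have [[n xn]|nx] := pselect (exists n, x = f n).
    by exists (f n.+1); [case: (fP n.+1)|right; split=> //; left; exists n].
  exists x => //; right; split=> //; right; split=> // n xn; apply: nx.
  by exists n.
move=> x x' y _ _ [[-> ->]|[xc H]] [[-> //]|].
- move=> [_ [[n _ /fI//]|[H E]]]; by case: (H 0%N).
- move=> E; case: H => [[n _ F]|[H F]]; first by move: F; rewrite E => /fI.
  by case: (H 0%N); rewrite -F.
move=> [x'c H']; case: H H' => [[n -> ->]|[H ->]] [[m ->]|[H' //]].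
- by move=> /fI[->].
- by move=> E; case: (H' n.+1).
- by move=> E; case: (H m.+1).
Qed.

(** * Squares of infinite cardinals *)

Section Hessenberg.
Context {d : Order.disp_t} {T : orderType d}.
Hypothesis wo : well_order (<=%O : rel T).

Let mx (p : T * T) := Order.max p.1 p.2.

(** Goedel's well-ordering of pairs: by maximum, then lexicographically. *)
Let R (q p : T * T) := mx q < mx p \/
  mx q = mx p /\ (q.1 < p.1 \/ q.1 = p.1 /\ q.2 < p.2).

Let Rwf : well_founded R.
Proof.
suff H m : forall p, mx p = m -> Acc R p by move=> p; exact: (H (mx p)).
elim/(wo_ind wo) : m => m IHm.
suff H a : forall p, mx p = m -> p.1 = a -> Acc R p by move=> p pm; exact: (H p.1).
elim/(wo_ind wo) : a => a IHa.
suff H b : forall p, mx p = m -> p.1 = a -> p.2 = b -> Acc R p.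
  by move=> p pm pa; exact: (H p.2).
elim/(wo_ind wo) : b => b IHb p pm pa pb; constructor => q [qp|[E [qp|[E1 qp]]]].
- by apply: (IHm (mx q)) => //; rewrite -pm.
- by apply: (IHa q.1) => //; rewrite -?pa// E.
- by apply: (IHb q.2) => //; rewrite -?pb ?E ?E1.
Qed.

Let Rtot p q : p = q \/ R p q \/ R q p.
Proof.
rewrite /R; case: (ltgtP (mx p) (mx q)) => [H|H|E]; [by right; left; left|by right; right; left|].
case: (ltgtP p.1 q.1) => [H|H|E1]; [by right; left; right; split=> //; left|
  by right; right; right; split=> //; left|].
case: (ltgtP p.2 q.2) => [H|H|E2].
- by right; left; right; split=> //; right.
- by right; right; right; split=> //; right.
- by left; case: p q E1 E2 {E} => ? ? [? ?] /= -> ->.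
Qed.

(** The [R]-predecessors of a pair in [D] lie in the square of a proper segment. By finiteness or by
    the last two hypotheses, [D] does not inject into that square, so [greedy] applies. *)
Lemma sqr_le_initial (D : set T) : [set: nat] #<= D ->
  (forall x y, D x -> y < x -> D y) ->
  (forall x, D x -> ~ (D #<= [set y | y < x])) ->
  (forall x, D x -> [set: nat] #<= [set y | y < x] ->
     [set y | y < x] `*` [set y | y < x] #<= [set y | y < x]) ->
  D `*` D #<= D.
Proof.
move=> Dinf Ddc Dini Dsq.
have Dlim x : D x -> exists2 y, D y & x < y.
  move=> Dx; apply: contrapT => N.
  have DE z : D z -> z <= x.
    by move=> Dz; rewrite leNgt; apply/negP => zx; apply: N; exists z.
  have sub : D `<=` x |` [set y | y < x].
    move=> z /DE; rewrite le_eqVlt => /orP[/eqP->|zx]; [by left|by right].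
  have [fin|inf] := pselect (finite_set [set y | y < x]).
    by move/infiniteP: Dinf; apply; apply: sub_finite_set sub _; rewrite finite_setU; split.
  apply: (Dini x Dx); apply: card_le_trans (subset_card_le sub) _.
  by apply: card_le_add1; apply/infiniteP.
have sqsmall x : D x -> ~ (D #<= [set y | y < x] `*` [set y | y < x]).
  move=> Dx H; have [fin|inf] := pselect (finite_set [set y | y < x]).
    by move/infiniteP: Dinf; apply; apply: card_le_finite H _; exact: finite_setX.
  by apply: (Dini x Dx); apply: card_le_trans H _; apply: Dsq => //; apply/infiniteP.
apply: (greedy Rwf Rtot) => -[a b] [/= Da Db] H.
have Dm : D (mx (a, b)) by rewrite /mx /= /Order.max; case: ifP.
have [c Dc mc] := Dlim _ Dm.
apply: (sqsmall c Dc); apply: card_le_trans H _; apply: subset_card_le.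
move=> q [_ Rq].
have qc : mx q < c.
  by case: Rq => [qp|[-> _]] //; apply: lt_trans qp mc.
by move: qc; rewrite /mx gt_max => /andP[].
Qed.

Lemma sqr_seg_le x : [set: nat] #<= [set y | y < x] ->
  [set y : T | y < x] `*` [set y | y < x] #<= [set y | y < x].
Proof.
elim/(wo_ind wo) : x => x IH inf.
have [[y yx xy]|N] := pselect (exists2 y, y < x & [set z | z < x] #<= [set z | z < y]).
  apply: card_le_trans (card_le_sqr xy) _.
  apply: card_le_trans (IH _ yx _) _; first exact: card_le_trans xy.
  by apply: subset_card_le => z /= zy; apply: lt_trans yx.
apply: sqr_le_initial => //.
- by move=> u v /= ux vu; apply: lt_trans ux.
- by move=> y yx H; apply: N; exists y.
Qed.

End Hessenberg.

Section Cardinals.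
Variable M : cardinal.
Let wo := card_wo (c := M).

Lemma sqr_card_le : aleph0_le M -> [set: M] `*` [set: M] #<= [set: M].
Proof.
move=> inf; apply: (sqr_le_initial wo) => //.
- by move=> x _; apply/negP; exact: card_initial.
- by move=> x _; exact: (sqr_seg_le wo).
Qed.

(** Since [M] does not inject into [X], the hypothesis of [greedy] fails at some [m], and there [X]
    injects into the segment below [m]. *)
Lemma card_cmp (U : Type) (X : set U) : ~ ([set: M] #<= X) ->
  exists m : M, X #<= [set y | y < m].
Proof.
move=> H; apply: contrapT => N; apply: H.
apply: (greedy (wo_wf wo)).
  by move=> p q; case: (ltgtP p q) => [?|?|?]; [right; left|right; right|left].
move=> p _ XH; apply: N; exists p; apply: card_le_trans XH _.
by apply: subset_card_le => y [].
Qed.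

End Cardinals.

(** * Stationary sets in successor cardinals *)

Definition small (M : cardinal) (U : Type) (X : set U) : Prop :=
  ~ ([set: M] #<= X).

Lemma small_le (M : cardinal) (U V : Type) (X : set U) (Y : set V) :
  X #<= Y -> small M Y -> small M X.
Proof. by move=> XY sY H; apply: sY; apply: card_le_trans XY. Qed.

Lemma small_card_le (M : cardinal) (U : Type) (X : set U) :
  small M X -> X #<= [set: M].
Proof. by move=> /card_cmp[m H]; apply: card_le_trans H _; exact: card_leT. Qed.

Section Regular.
Variable M : cardinal.
Hypothesis regM : regular M.
Let wo := card_wo (c := M).

Lemma reg_infinite : ~ finite_set [set: M].
Proof. by case: regM => /infiniteP. Qed.

Lemma reg_inhabited : exists m : M, True.
Proof.
apply: contrapT => N; apply: reg_infinite; rewrite (_ : [set: M] = set0) //.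
by apply/seteqP; split=> // x _; case: N; exists x.
Qed.

Lemma small_finite (U : Type) (X : set U) : finite_set X -> small M X.
Proof. by move=> fX H; apply: reg_infinite; apply: card_le_finite H fX. Qed.

(** An unbounded image would be cofinal, and regularity would inject [M] into it and hence into
    [X]. *)
Lemma reg_bound (U : Type) (X : set U) (f : U -> M) :
  small M X -> exists m, forall x, X x -> f x < m.
Proof.
move=> sX; apply: contrapT => N; apply: sX.
apply: (card_le_trans _ (card_image_le f X)); apply: regM.2 => m.
apply: contrapT => Nm; apply: N; exists m => x Xx; rewrite ltNge; apply/negP => mx.
by apply: Nm; exists (f x) => //; exists x.
Qed.

Lemma reg_gt (m : M) : exists m', m < m'.
Proof.
have [m' H] := reg_bound (fun _ : unit => m) (small_finite (finite_set1 tt)).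
by exists m'; exact: (H tt).
Qed.

Lemma small_lt (m : M) : small M [set x | x < m].
Proof. by apply/negP; exact: card_initial. Qed.

Lemma reg_seq_bound (U : eqType) (s : seq U) (f : U -> M) :
  exists m, forall x, x \in s -> f x < m.
Proof.
elim: s => [|x s [m IH]]; first by have [m _] := reg_inhabited; exists m.
have [m' mm'] := reg_gt (Order.max m (f x)).
exists m' => y; rewrite in_cons => /orP[/eqP->|/IH ym]; apply: le_lt_trans mm'.
  by rewrite le_max lexx orbT.
by rewrite le_max (ltW ym).
Qed.

Lemma le_add1_card (U : Type) (A : set U) (c : U) :
  A #<= [set: M] -> c |` A #<= [set: M].
Proof.
move=> AM; have [fA|iA] := pselect (finite_set A).
  apply: card_le_trans (regM.1 : [set: nat] #<= _).
  by apply: finite_set_countable; rewrite finite_setU; split.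
by apply: card_le_trans AM; apply: card_le_add1; apply/infiniteP.
Qed.

End Regular.

Lemma card_le_fun (U V : Type) (A : set U) (B : set V) (v0 : V) :
  A #<= B -> exists f : U -> V, (forall x, A x -> B (f x)) /\
    (forall x y, A x -> A y -> f x = f y -> x = y).
Proof.
move=> /card_leE[r [r1 r2]].
exists (fun x => pickd v0 (fun y => B y /\ r x y)).
have H x : A x -> B (pickd v0 (fun y => B y /\ r x y)) /\
    r x (pickd v0 (fun y => B y /\ r x y)).
  move=> Ax; apply: (@pickdP _ v0 (fun y => B y /\ r x y)).
  by have [y By rxy] := r1 _ Ax; exists y.
split=> [x Ax|x y Ax Ay E]; first exact: (H _ Ax).1.
apply: (r2 _ _ _ Ax Ay (H _ Ax).2).
by rewrite E; exact: (H _ Ay).2.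
Qed.

Lemma card_le_surj (U V : Type) (v0 : V) :
  [set: V] #<= [set: U] -> exists f : U -> V, forall v, exists u, f u = v.
Proof.
move=> /card_leE[r [r1 r2]].
exists (fun u => pickd v0 (fun v => r v u)) => v.
have [u _ ru] := r1 v I; exists u.
apply: (r2 _ _ u) => //; apply: (@pickdP _ v0 (fun v => r v u)).
by exists v.
Qed.

(** If every [x] failed from some stage on, nothing could hold beyond a common bound of these
    stages. *)
Lemma pigeon d (T : orderType d) (A : set T) (D : Type) (Q : T -> D -> Prop) :
  (forall f : D -> T, (forall x, A (f x)) -> exists2 b, A b & forall x, f x <= b) ->
  (forall t, A t -> exists t', [/\ A t', t <= t' & exists x, Q t' x]) ->
  exists x, forall t, A t -> exists t', [/\ A t', t <= t' & Q t' x].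
Proof.
move=> H1 H2; apply: contrapT => N.
have /choice[f fP] : forall x, exists t, A t /\ forall t', A t' -> t <= t' -> ~ Q t' x.
  move=> x; apply: contrapT => Nx; apply: N; exists x => t At.
  apply: contrapT => Nt; apply: Nx; exists t; split=> // t' At' tt' q.
  by apply: Nt; exists t'.
have [b Ab fb] := H1 f (fun x => (fP x).1).
have [t' [At' bt' [x qx]]] := H2 _ Ab.
by apply: ((fP x).2 _ At' _ qx); apply: le_trans bt'.
Qed.

(** Stationarity, with closure points of functions in place of closed unbounded sets; on regular
    uncountable cardinals this is the usual notion. *)
Definition stat {d} {T : orderType d} (A : set T) : Prop :=
  forall (F : T -> T) (b : T),
    exists x, [/\ A x, b < x & forall y, y < x -> F y < x].

(** The points of cofinality at least [M]. For infinite [M], asking for strict bounds [b < x]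
    excludes the least point and successors. *)
Definition cofS (M : cardinal) {d} (T : orderType d) : set T :=
  [set x | forall X : set T, small M X -> (forall y, X y -> y < x) ->
     exists2 b, b < x & forall y, X y -> y < b].
Arguments cofS M {d} T _.

Lemma stat_sub d (T : orderType d) (A B : set T) : A `<=` B -> stat A -> stat B.
Proof. by move=> AB sA F b; have [x [/AB]] := sA F b; exists x. Qed.

Lemma stat_gt d (T : orderType d) (A : set T) (b : T) : stat A ->
  stat [set x | A x /\ b < x].
Proof.
move=> sA F c; have [x [Ax cx Fx]] := sA F (Order.max b c).
by move: cx; rewrite gt_max => /andP[bx cx]; exists x.
Qed.

Lemma cofS_bound (M : cardinal) d (T : orderType d) (x : T) (I : Type)
    (X : set I) (f : I -> T) : cofS M T x -> small M X ->
  (forall i, X i -> f i < x) -> exists2 b, b < x & forall i, X i -> f i < b.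
Proof.
move=> Sx sX fx; have [|y [i Xi <-]|b bx H] := Sx (f @` X).
- by apply: (small_le _ sX); exact: card_image_le.
- exact: fx.
- by exists b => // i Xi; apply: H; exists i.
Qed.

(** * Well-orders of type the successor cardinal of [M] *)

Section Successor.
Variable M : cardinal.
Hypothesis regM : regular M.
Context {d : Order.disp_t} {T : orderType d}.
Hypothesis wo : well_order (<=%O : rel T).
Hypothesis segT : forall x : T, [set y | y < x] #<= [set: M].
Hypothesis bigT : ~ ([set: T] #<= [set: M]).

Lemma succ_inhabited : exists w : T, True.
Proof.
apply: contrapT => N0; apply: bigT; rewrite (_ : setT = set0) ?card_ge0 //.
by apply/seteqP; split=> // t _; case: N0; exists t.
Qed.

Lemma succ_gt (x : T) : exists y, x < y.
Proof.
apply: contrapT => N; apply: bigT; apply: card_le_trans (le_add1_card regM x (segT x)).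
apply: subset_card_le => y _; have [yx|xy|->] := ltgtP y x; [by right| |by left].
by case: N; exists y.
Qed.

Lemma succ_ge (x : T) : [set y | y <= x] #<= [set: M].
Proof.
have [x' xx'] := succ_gt x; apply: card_le_trans (segT x').
by apply: subset_card_le => y /= yx; apply: le_lt_trans xx'.
Qed.

Lemma succ_inj : exists e : T -> T -> M,
  forall b x y, x < b -> y < b -> e b x = e b y -> x = y.
Proof.
have [m0 _] := reg_inhabited regM.
have /choice[e eP] : forall b : T, exists f : T -> M,
    forall x y, x < b -> y < b -> f x = f y -> x = y.
  by move=> b; have [f [_ fI]] := card_le_fun m0 (segT b); exists f.
by exists e.
Qed.

(** Regularity of the successor: were [X] unbounded, each [t] would be determined by the code in [M]
    of some larger [x] in [X] and the index [e x t], so [T] would inject into [M * M]. *)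
Lemma succ_bound_set (X : set T) :
  X #<= [set: M] -> exists b, forall x, X x -> x < b.
Proof.
move=> XM; apply: contrapT => N.
have cofX t : exists2 x, X x & t < x.
  have [t' tt'] := succ_gt t; apply: contrapT => Nt; apply: N; exists t' => x Xx.
  by rewrite ltNge; apply/negP => t'x; apply: Nt; exists x => //; apply: lt_le_trans t'x.
apply: bigT; apply: card_le_trans (sqr_card_le regM.1).
have [m0 _] := reg_inhabited regM.
have [r [_ rI]] := card_le_fun m0 XM.
have [e eI] := succ_inj.
apply/card_leE; exists (fun t p => exists x, [/\ X x, t < x, r x = p.1 & e x t = p.2]).
split=> [t _|t t' [m1 m2] _ _ [x [/= Xx tx rx ex]] [x' [/= Xx' tx' rx' ex']]].
  by have [x Xx tx] := cofX t; exists (r x, e x t) => //; exists x.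
have xx' : x = x' by apply: rI => //; rewrite rx.
by rewrite -xx' in tx' ex'; apply: (eI x) => //; rewrite ex.
Qed.

Lemma succ_bound (I : Type) (X : set I) (f : I -> T) :
  X #<= [set: M] -> exists b, forall i, X i -> f i < b.
Proof.
move=> XM; have [|b H] := @succ_bound_set (f @` X).
  by apply: card_le_trans XM; exact: card_image_le.
by exists b => i Xi; apply: H; exists i.
Qed.

(** Build a sequence of length [M] in which each term exceeds [G] of all earlier ones. Its supremum
    is closed under [F], and has cofinality [M] because [M] is regular. *)
Lemma stat_cofS : stat (cofS M T).
Proof.
move=> F b.
have /choice[G GP] : forall x, exists g, x < g /\ forall y, y <= x -> F y < g.
  move=> x; have [c cP] := succ_bound F (succ_ge x); have [c' xc'] := succ_gt x.
  exists (Order.max c c'); rewrite lt_max xc' orbT; split=> // y yx.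
  by rewrite lt_max cP.
have woM := card_wo (c := M).
pose xs := Fix (wo_wf woM) (fun _ => T) (fun n rec =>
  pickd b (fun u => b < u /\ forall n' (h : n' < n), G (rec n' h) < u)).
have xsE n : xs n = pickd b (fun u => b < u /\ forall n', n' < n -> G (xs n') < u).
  rewrite /xs Fix_eq //= => x g g' gg'.
  suff -> : g = g' by [].
  apply: functional_extensionality_dep => y.
  by apply: functional_extensionality_dep => h; exact: gg'.
have xsP n : b < xs n /\ forall n', n' < n -> G (xs n') < xs n.
  rewrite [xs n]xsE.
  apply: (@pickdP _ b (fun u => b < u /\ forall n', n' < n -> G (xs n') < u)).
  have [|c cP] := @succ_bound _ [set n' : M | n' < n] (G \o xs); first exact: card_leT.
  have [c' bc'] := succ_gt b; exists (Order.max c c').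
  by rewrite lt_max bc' orbT; split=> // n' n'n; rewrite lt_max cP.
have [|x xP xmin] := @wo_min _ _ wo (fun x => forall n, xs n < x).
  by have [c cP] := succ_bound xs (card_lexx [set: M]); exists c => n; exact: cP.
have xlt y : y < x -> exists n, y <= xs n.
  move=> yx; apply: contrapT => N; move: yx; rewrite ltNge xmin // => n.
  by rewrite ltNge; apply/negP => H; apply: N; exists n.
exists x; split.
- move=> X sX Xx.
  have [m0 _] := reg_inhabited regM.
  pose nu y := pickd m0 (fun n => y <= xs n).
  have nuP y : X y -> y <= xs (nu y).
    by move=> Xy; apply: (@pickdP _ m0 (fun n => y <= xs n)); apply: xlt; exact: Xx.
  have [m mP] := reg_bound regM nu sX.
  exists (xs m) => // y Xy; apply: le_lt_trans (nuP _ Xy) _.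
  by apply: lt_trans ((xsP m).2 _ (mP _ Xy)); case: (GP (xs (nu y))).
- by have [m0 _] := reg_inhabited regM; apply: lt_trans (xP m0); case: (xsP m0).
- move=> y /xlt[n yn]; have [n' nn'] := reg_gt regM n.
  by apply: lt_trans (xP n'); apply: lt_trans ((xsP n').2 _ nn'); apply: (GP _).2.
Qed.

(** Counterexamples for all pieces, being at most [M] many, have a pointwise bound, which is a
    counterexample for [A]. *)
Lemma stat_union (A : set T) (I : Type) (B : I -> set T) :
  stat A -> [set: I] #<= [set: M] -> (forall x, A x -> exists i, B i x) ->
  exists i, stat [set x | A x /\ B i x].
Proof.
move=> sA IM AB; apply: contrapT => N.
have /choice[Fb FbP] : forall i, exists Fb : (T -> T) * T,
    ~ exists x, [/\ A x /\ B i x, Fb.2 < x & forall y, y < x -> Fb.1 y < x].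
  move=> i; apply: contrapT => Ni; apply: N; exists i => F b.
  by apply: contrapT => H; apply: Ni; exists (F, b).
have [b bP] := succ_bound (fun i => (Fb i).2) IM.
have /choice[F FP] : forall y, exists c, forall i, (Fb i).1 y < c.
  move=> y; have [c cP] := succ_bound (fun i => (Fb i).1 y) IM.
  by exists c => i; exact: cP.
have [x [Ax bx Fx]] := sA F b; have [i Bi] := AB _ Ax.
apply: (FbP i); exists x; split; [by split|by apply: lt_trans bx; exact: (bP i Logic.I)|move=> y yx].
by apply: lt_trans (FP y i) _; exact: Fx.
Qed.

(** Diagonalisation: were no fibre stationary, let [F] dominate at [x] the counterexamples of all
    [v <= x]. A point [x] of [A] closed under [F] contradicts the counterexample of its own value
    [f x]. *)
Lemma fodor (A : set T) (f : T -> T) : stat A -> (forall x, A x -> f x < x) ->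
  exists v, stat [set x | A x /\ f x = v].
Proof.
move=> sA fA; apply: contrapT => N.
have /choice[Fb FbP] : forall v, exists Fb : (T -> T) * T,
    ~ exists x, [/\ A x /\ f x = v, Fb.2 < x & forall y, y < x -> Fb.1 y < x].
  move=> v; apply: contrapT => Nv; apply: N; exists v => F b.
  by apply: contrapT => H; apply: Nv; exists (F, b).
have /choice[c cP] : forall p : T * T, exists c, (Fb p.1).2 < c /\
    forall y, y <= p.2 -> (Fb p.1).1 y < c.
  move=> [v x]; have [c cP] := succ_bound (Fb v).1 (succ_ge x).
  have [c' bc'] := succ_gt (Fb v).2.
  by exists (Order.max c c'); rewrite lt_max bc' orbT; split=> // y yx; rewrite lt_max cP.
have /choice[F FP] : forall x, exists u, forall v, v <= x -> c (v, x) < u.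
  by move=> x; have [u uP] := succ_bound (fun v => c (v, x)) (succ_ge x); exists u.
have [w0 _] := succ_inhabited.
have [x [Ax bx Fx]] := sA F w0.
apply: (FbP (f x)); exists x; split; [by split| |move=> y yx].
  apply: lt_trans (cP (f x, f x)).1 _.
  by apply: lt_trans (FP _ _ (lexx _)) _; apply: Fx; exact: fA.
pose z := Order.max (f x) y.
have zx : z < x by rewrite gt_max yx fA.
apply: lt_trans (Fx z zx).
apply: lt_trans (FP z (f x) _); last by rewrite le_max lexx.
by apply: (cP (f x, z)).2; rewrite le_max lexx orbT.
Qed.

(* Ulam's matrix: for a suitable row [nu], the sets {x | e x v = nu} give
   pairwise disjoint stationary pieces for unboundedly many [v]. *)
Lemma ulam (A : set T) : stat A ->
  exists p : T -> T, forall v, stat [set x | A x /\ p x = v].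
Proof.
move=> sA; have [e eI] := succ_inj; have [m0 _] := reg_inhabited regM.
have /choice[nu nuP] : forall v, exists n, stat [set x | (A x /\ v < x) /\ e x v = n].
  move=> v; have [||n H] := @stat_union _ M (fun n => [set x | e x v = n]) (stat_gt v sA).
  - exact: card_lexx.
  - by move=> x _; exists (e x v).
  - by exists n.
(* Otherwise each [v] is determined by its row and a code in [M] within that row. *)
have [n nbig] : exists n, ~ ([set v | nu v = n] #<= [set: M]).
  apply: contrapT => N; apply: bigT; apply: card_le_trans (sqr_card_le regM.1).
  have /choice[r rP] : forall n, exists r : T -> M,
      forall x y, nu x = n -> nu y = n -> r x = r y -> x = y.
    move=> n; have [|r [_ rI]] := @card_le_fun _ _ [set v | nu v = n] [set: M] m0.
      by apply: contrapT => H; apply: N; exists n.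
    by exists r.
  apply/card_leE; exists (fun v p => p = (nu v, r (nu v) v)).
  split=> [v _|v v' p _ _ -> [E1 E2]]; first by exists (nu v, r (nu v) v).
  by apply: (rP (nu v)) => //; rewrite E2 E1.
have TV : [set: T] #<= [set v | nu v = n].
  apply: (greedy (wo_wf wo)).
    by move=> p q; case: (ltgtP p q) => [?|?|?]; [right; left|right; right|left].
  move=> p _ H; apply: nbig; apply: card_le_trans H _; apply: card_le_trans (segT p).
  by apply: subset_card_le => y [].
have [w0 _] := succ_inhabited.
have [vm [vmV vmI]] := card_le_fun w0 TV.
(* The [w] picked for [x] is unique, because [e x] is injective below [x] and [vm] is injective. *)
exists (fun x => pickd w0 (fun w => vm w < x /\ e x (vm w) = n)) => w.
apply: stat_sub (nuP (vm w)) => x [[Ax vx] ex]; split=> //.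
have ew : e x (vm w) = n by rewrite ex; exact: (vmV w I).
have [] : vm (pickd w0 (fun w => vm w < x /\ e x (vm w) = n)) < x /\
    e x (vm (pickd w0 (fun w => vm w < x /\ e x (vm w) = n))) = n.
  by apply: (@pickdP _ w0 (fun w => vm w < x /\ e x (vm w) = n)); exists w.
by move=> h1 h2; apply: vmI => //; apply: (eI x) => //; rewrite h2 ew.
Qed.

End Successor.

(** * Subadditive functions and walks *)

(** Regularity bounds the sizes of [X] and of all [B x] by one proper segment [W], and the union
    injects into [W * W]. A finite [W] is treated apart. *)
Lemma small_bigcup (M : cardinal) (U V : Type) (X : set U) (B : U -> set V) :
  regular M -> small M X -> (forall x, X x -> small M (B x)) ->
  small M [set v | exists2 x, X x & B x v].
Proof.
move=> regM sX sB; have [m0 _] := reg_inhabited regM.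
have /choice[g gP] : forall x, exists m : M, X x -> B x #<= [set y | y < m].
  move=> x; have [Xx|nX] := pselect (X x); last by exists m0.
  by have [m mP] := card_cmp (sB _ Xx); exists m.
have [m1 m1P] := reg_bound regM g sX.
have [m2 m2P] := card_cmp sX.
pose m := Order.max m1 m2.
pose W := [set y : M | y < m].
have XW : X #<= W.
  by apply: card_le_trans m2P _; apply: subset_card_le => y /= ym; rewrite /W /= lt_max ym orbT.
have BW x : X x -> B x #<= W.
  move=> Xx; apply: card_le_trans (gP _ Xx) _; apply: subset_card_le => y /= ym.
  by rewrite /W /= lt_max (lt_trans ym (m1P _ Xx)).
have UW : [set v | exists2 x, X x & B x v] #<= W `*` W.
  have [r [rW rI]] := card_le_fun m0 XW.
  have /choice[s sP] : forall x, exists s : V -> M, X x ->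
      (forall v, B x v -> W (s v)) /\
      (forall v v', B x v -> B x v' -> s v = s v' -> v = v').
    move=> x; have [Xx|nX] := pselect (X x); last by exists (fun=> m0).
    by have [s sP] := card_le_fun m0 (BW _ Xx); exists s.
  apply/card_leE; exists (fun v p => exists x, [/\ X x, B x v, r x = p.1 & s x v = p.2]).
  split=> [v [x Xx Bv]|v v' [p q] _ _ [x [/= Xx Bx rx sx]] [x' [/= Xx' Bx' rx' sx']]].
    exists (r x, s x v); last by exists x.
    by split=> /=; [exact: rW|exact: (sP _ Xx).1].
  have xx' : x = x' by apply: rI => //; rewrite rx.
  by rewrite -xx' in Bx' sx'; apply: (sP _ Xx).2 => //; rewrite sx.
apply: (small_le UW); have [fW|iW] := pselect (finite_set W).
  by apply: (small_finite regM); exact: finite_setX.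
apply: (small_le (sqr_seg_le (card_wo (c := M)) _)); last exact: small_lt.
exact/infiniteP.
Qed.

Section Subadditive.
Variable M : cardinal.
Hypothesis regM : regular M.
Context {d : Order.disp_t} {T : orderType d}.
Hypothesis wo : well_order (<=%O : rel T).
Variable e : T -> T -> M.
Hypothesis eI : forall b x y, x < b -> y < b -> e b x = e b y -> x = y.

(* [lo n x y] are tree orders increasing with [n]; the elements of the branch
   below [y] are taken from the longest initial part of the enumeration [e y]
   that is already a chain for [lo n]. *)
Inductive lo (n : M) : T -> T -> Prop :=
| lo_base x y : x < y -> e y x < n ->
    (forall a b, a < b -> b < y -> e y a <= e y x -> e y b <= e y x -> lo n a b) ->
    lo n x y
| lo_step x y z : x < y -> e y x < n ->
    (forall a b, a < b -> b < y -> e y a <= e y x -> e y b <= e y x -> lo n a b) ->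
    lo n z x -> lo n z y.

Lemma loE n z y : lo n z y -> exists x, [/\ x < y, e y x < n,
    (forall a b, a < b -> b < y -> e y a <= e y x -> e y b <= e y x -> lo n a b) &
    z = x \/ lo n z x].
Proof.
by case=> [x {}y xy ex H|x {}y {}z xy ex H zx]; exists x; split=> //; [left|right].
Qed.

Lemma lo_lt n z y : lo n z y -> z < y.
Proof.
elim/(wo_ind wo) : y z => y IH z /loE[x [xy _ _ [->//|/(IH _ xy) zx]]].
exact: lt_trans xy.
Qed.

Lemma lo_mono n n' z y : n <= n' -> lo n z y -> lo n' z y.
Proof.
move=> nn'; elim/(wo_ind wo) : y z => y IH z /loE[x [xy ex H zx]].
have ex' : e y x < n' by apply: lt_le_trans nn'.
have H' a b : a < b -> b < y -> e y a <= e y x -> e y b <= e y x -> lo n' a b.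
  by move=> ab by_ ea eb; apply: IH => //; exact: H.
case: zx => [->|zx]; first exact: lo_base.
by apply: (lo_step xy ex' H'); exact: IH.
Qed.

Lemma lo_trans n x y z : lo n x y -> lo n z x -> lo n z y.
Proof.
elim/(wo_ind wo) : y x z => y IH x z /loE[w [wy ew H [->|xw]]] zx.
  exact: lo_step wy ew H zx.
by apply: (lo_step wy ew H); exact: (IH _ wy _ _ xw zx).
Qed.

(** The [lo n]-predecessors of [y] form a chain: they are reached through [w] and [w'], and the
    chain condition of the one with larger index for [e y] covers both. *)
Lemma lo_coherent n x y z : lo n x y -> lo n z y -> z < x -> lo n z x.
Proof.
elim/(wo_ind wo) : y x z => y IH x z /loE[w [wy ew H xw]] /loE[w' [w'y ew' H' zw']] zx.
have xlew : x <= w by case: xw => [->//|/lo_lt/ltW].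
have zlew : z <= w' by case: zw' => [->//|/lo_lt/ltW].
have lo_chain a b : a < b -> b < y -> (a = w /\ b = w') \/ (a = w' /\ b = w) -> lo n a b.
  move=> ab by_ ab'; have [ww'|/ltW w'w] := leP (e y w) (e y w').
    by apply: H' => //; case: ab' => -[aE bE]; rewrite ?aE ?bE.
  by apply: H => //; case: ab' => -[aE bE]; rewrite ?aE ?bE.
have [ww'|w'w|ww'] := ltgtP w w'.
- have lww' : lo n w w' by apply: lo_chain => //; left.
  have lxw' : lo n x w' by case: xw => [->//|]; exact: lo_trans.
  case: zw' => [zE|zw']; last exact: (IH w').
  by move: zx; rewrite zE ltNge (le_trans xlew (ltW ww')).
- have lw'w : lo n w' w by apply: lo_chain => //; right.
  have lzw : lo n z w by case: zw' => [->//|]; exact: lo_trans.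
  by case: xw => [->//|xw]; exact: (IH w).
- case: zw' => [zE|zw']; first by move: zx; rewrite zE -ww' ltNge xlew.
  by rewrite -ww' in zw'; case: xw => [->//|xw]; exact: (IH w).
Qed.

Lemma small_enum y (m : M) : small M [set x | x < y /\ e y x < m].
Proof.
apply: (small_le _ (@small_lt M m)); apply/card_leE; exists (fun x n => e y x = n).
split=> [x [xy xm]|x x' n [xy _] [x'y _] E E']; first by exists (e y x).
by apply: (eI (b := y)) => //; rewrite E.
Qed.

Lemma small_lo n y : small M [set x | lo n x y].
Proof.
elim/(wo_ind wo) : y => y IH.
have := @small_bigcup M T T [set x | x < y /\ e y x < n]
  (fun x => [set z | z = x \/ lo n z x]) regM (@small_enum y n).
move=> H; apply: small_le (H _).
  by apply: subset_card_le => z /loE[x [xy ex _ zx]]; exists x.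
move=> x [xy _].
have := @small_bigcup M bool T setT (fun b => if b then [set x] else [set z | lo n z x]) regM.
move=> H'; apply: small_le (H' _ _).
- by apply: subset_card_le => z [->|zx]; [exists true|exists false].
- exact: (small_finite regM).
- by move=> [] _; [apply: (small_finite regM); exact: finite_set1|exact: IH].
Qed.

(** Fewer than [M] points have index at most that of [x]. By induction each pair of them is related
    at some level, and regularity gives one level for all pairs. *)
Lemma lo_exists x y : x < y -> exists n, lo n x y.
Proof.
elim/(wo_ind wo) : y x => y IH x xy.
have [m0 _] := reg_inhabited regM.
have /choice[g gP] : forall p : T * T, exists n, p.1 < p.2 -> p.2 < y -> lo n p.1 p.2.
  move=> [a b] /=; have [[ab by_]|N] := pselect (a < b /\ b < y).
    by have [n lab] := IH _ by_ _ ab; exists n.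
  by exists m0 => ab by_; case: N.
have [m em] := reg_gt regM (e y x).
have sm := @small_enum y m.
have /choice[h hP] : forall b, exists n, forall a, a < y /\ e y a < m -> g (a, b) < n.
  by move=> b; have [n nP] := reg_bound regM (fun a => g (a, b)) sm; exists n.
have [n nP] := reg_bound regM h sm.
exists (Order.max n m); apply: lo_base => //; first by rewrite lt_max em orbT.
move=> a b ab by_ ea eb.
apply: (lo_mono _ (gP (a, b) ab by_)); rewrite le_max; apply/orP; left.
have ay : a < y by apply: lt_trans by_.
apply/ltW; apply: lt_trans (hP b a _) _; first by split=> //; exact: le_lt_trans em.
by apply: nP; split=> //; exact: le_lt_trans em.
Qed.

(** Take for [rho x y] the least [n] with [lo n x y]. The inequalities are transitivity and
    coherence of [lo]; the last clause is [small_lo]. *)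
Lemma subadditive : exists rho : T -> T -> M, [/\
  forall x y z, x < y -> y < z -> rho x z <= Order.max (rho x y) (rho y z),
  forall x y z, x < y -> y < z -> rho x y <= Order.max (rho x z) (rho y z) &
  forall y n, small M [set x | x < y /\ rho x y <= n]].
Proof.
have [m0 _] := reg_inhabited regM.
have /choice[r rP] : forall p : T * T, exists n, p.1 < p.2 ->
    lo n p.1 p.2 /\ forall n', lo n' p.1 p.2 -> n <= n'.
  move=> [x y] /=; have [xy|N] := pselect (x < y); last by exists m0.
  by have [n ln nmin] := wo_min (card_wo (c := M)) (lo_exists xy); exists n.
have rlo x y n : x < y -> r (x, y) <= n -> lo n x y.
  by move=> xy H; exact: lo_mono H (rP (x, y) xy).1.
exists (fun x y => r (x, y)); split=> [x y z xy yz|x y z xy yz|y n].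
- apply: (rP (x, z) (lt_trans xy yz)).2; apply: (lo_trans (x := y)).
    by apply: rlo => //; rewrite le_max lexx orbT.
  by apply: rlo => //; rewrite le_max lexx.
- apply: (rP (x, y) xy).2; apply: (lo_coherent (y := z)) => //.
    by apply: rlo => //; rewrite le_max lexx orbT.
  by apply: rlo => //; [exact: lt_trans yz|rewrite le_max lexx].
- apply: small_le (@small_lo n y); apply: subset_card_le => x [xy H].
  exact: rlo.
Qed.

End Subadditive.

(** * Walks along the indexing [e] *)

Section Walks.
Variable M : cardinal.
Hypothesis regM : regular M.
Context {d : Order.disp_t} {T : orderType d}.
Hypothesis wo : well_order (<=%O : rel T).
Variable e : T -> T -> M.
Hypothesis eI : forall b x y, x < b -> y < b -> e b x = e b y -> x = y.

Definition next (a b : T) : T := pickd a (fun y => [/\ a <= y, y < b &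
  forall y', a <= y' -> y' < b -> e b y <= e b y']).

Lemma nextP a b : a < b -> [/\ a <= next a b, next a b < b &
  forall y', a <= y' -> y' < b -> e b (next a b) <= e b y'].
Proof.
move=> ab; apply: (@pickdP _ a (fun y => [/\ a <= y, y < b &
  forall y', a <= y' -> y' < b -> e b y <= e b y'])).
have [|m [y [ay yb <-]] ym] := wo_min (card_wo (c := M)) (P := fun m => exists y, [/\ a <= y, y < b & e b y = m]).
  by exists (e b a), a.
by exists y; split=> // y' ay' y'b; apply: ym; exists y'.
Qed.

Lemma next_uniq a b y : a <= y -> y < b ->
  (forall y', a <= y' -> y' < b -> e b y <= e b y') -> y = next a b.
Proof.
move=> ay yb H; have ab := le_lt_trans ay yb; have [n1 n2 n3] := nextP ab.
by apply: (eI (b := b)) => //; apply/eqP; rewrite eq_le H // n3.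
Qed.

Inductive is_walk (a : T) : T -> seq T -> Prop :=
| walk_refl : is_walk a a [:: a]
| walk_step b s : a < b -> is_walk a (next a b) s -> is_walk a b (b :: s).

Lemma is_walk_ex a b : a <= b -> exists s, is_walk a b s.
Proof.
elim/(wo_ind wo) : b => b IH; rewrite le_eqVlt => /orP[/eqP<-|ab].
  by exists [:: a]; constructor.
have [n1 n2 _] := nextP ab; have [s ws] := IH _ n2 n1.
by exists (b :: s); constructor.
Qed.

Lemma is_walk_uniq a b s s' : is_walk a b s -> is_walk a b s' -> s = s'.
Proof.
move=> ws; elim: ws s' => [|{}b {}s ab _ IH] s' w.
  by inversion w => //; move: H; rewrite ltxx.
inversion w; first by move: ab; rewrite H ltxx.
by congr cons; exact: IH.
Qed.

Lemma is_walk_cons a b s : is_walk a b s -> exists t, s = b :: t.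
Proof. by case=> [|{}b t _ _]; [exists [::]|exists t]. Qed.

Definition walk (a b : T) : seq T := pickd [::] (is_walk a b).

Lemma walkP a b : a <= b -> is_walk a b (walk a b).
Proof. by move=> ab; apply: pickdP; exact: is_walk_ex. Qed.

Lemma walk_self a : walk a a = [:: a].
Proof. by apply: is_walk_uniq (walkP (lexx a)) _; constructor. Qed.

Lemma walk_cons a b : a < b -> walk a b = b :: walk a (next a b).
Proof.
move=> ab; apply: is_walk_uniq (walkP (ltW ab)) _; constructor => //.
by apply: walkP; case: (nextP ab).
Qed.

Definition steps (a b : T) : seq T := belast b (behead (walk a b)).

Lemma walk_steps a b : a <= b -> walk a b = rcons (steps a b) a.
Proof.
move=> /walkP w; rewrite /steps; elim: w => [//|{}b s ab w IH] /=.
have [t st] := is_walk_cons w.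
by move: IH; rewrite st /= => ->.
Qed.

Lemma steps_self a : steps a a = [::].
Proof. by rewrite /steps walk_self. Qed.

Lemma steps_cons a b : a < b -> steps a b = b :: steps a (next a b).
Proof.
move=> ab; have [n1 _ _] := nextP ab.
apply: (@rcons_injl _ a); rewrite /= -!walk_steps ?(ltW ab) //.
exact: walk_cons.
Qed.

(** At a node [z] above [x], passing from [[x, z)] to [[a, z)] adds only points of larger index, so
    the step stays the same. *)
Lemma walk_pass a x b : a <= x -> x <= b ->
  (forall z, z \in steps x b -> forall y, a <= y -> y < x -> e z (next x z) < e z y) ->
  walk a b = steps x b ++ walk a x.
Proof.
move=> ax; elim/(wo_ind wo) : b => b IH; rewrite le_eqVlt => /orP[/eqP<- _|xb].
  by rewrite steps_self.
rewrite steps_cons // => H; have [n1 n2 n3] := nextP xb.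
have ab := le_lt_trans ax xb.
have nE : next x b = next a b.
  apply: next_uniq => //; first exact: le_trans n1.
  move=> y ay yb; have [yx|xy] := ltP y x; last exact: n3.
  by apply/ltW; apply: H => //; exact: mem_head.
rewrite walk_cons // -nE /= IH // => z zs; apply: H.
by rewrite in_cons zs orbT.
Qed.

Lemma steps_gt x b z : x <= b -> z \in steps x b -> x < z /\ next x z < z.
Proof.
elim/(wo_ind wo) : b => b IH; rewrite le_eqVlt => /orP[/eqP<-|xb].
  by rewrite steps_self.
have [n1 n2 _] := nextP xb.
by rewrite steps_cons // in_cons => /orP[/eqP->//|]; exact: IH.
Qed.

Lemma steps_head x b : x < b -> b \in steps x b.
Proof. by move=> xb; rewrite steps_cons // mem_head. Qed.

(** For each of the finitely many nodes [z] above [x], fewer than [M] points below [x] have index at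
    most that of [next x z]; the cofinality of [x] bounds them below [x]. *)
Lemma pass1 x b : cofS M T x -> x < b -> exists2 c, c < x &
  forall a, c <= a -> a < x -> walk a b = steps x b ++ walk a x.
Proof.
move=> Sx xb.
have H z : exists c, z \in steps x b -> c < x /\
    forall y, c <= y -> y < x -> e z (next x z) < e z y.
  have [zs|nz] := boolP (z \in steps x b); last by exists x.
  have [xz nz] := steps_gt (ltW xb) zs.
  have [m em] := reg_gt regM (e z (next x z)).
  have [|y [yx _] //|c cx cP] := Sx [set y | y < x /\ e z y < m].
    apply: (small_le _ (@small_enum M d T e eI z m)); apply: subset_card_le.
    by move=> y [yx ym]; split=> //; exact: lt_trans xz.
  exists c => _; split=> // y cy yx; rewrite ltNge; apply/negP => eyn.
  have /cP : y < x /\ e z y < m by split=> //; exact: le_lt_trans em.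
  by rewrite ltNge cy.
have /choice[c cP] := H.
suff [c0 c0x c0P] : exists2 c0, c0 < x & forall z, z \in steps x b -> c z <= c0.
  exists c0 => // a c0a ax; apply: walk_pass; rewrite ?ltW // => z zs y ay yx.
  by apply: (cP z zs).2 => //; apply: le_trans ay; apply: le_trans c0a; exact: c0P.
have [c0 c0x _] := Sx set0 (small_finite regM (finite_set0 _)) (fun _ => False_ind _).
elim: (steps x b) (fun z zs => (cP z zs).1) => [_|z s IH zs]; first by exists c0.
have [|c1 c1x c1P] := IH; first by move=> y ys; apply: zs; rewrite in_cons ys orbT.
exists (Order.max (c z) c1); first by rewrite gt_max c1x zs // mem_head.
move=> y; rewrite in_cons => /orP[/eqP->|/c1P ys]; first by rewrite le_max lexx.
by rewrite le_max ys orbT.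
Qed.

Lemma pass x (I : Type) (b : I -> T) : cofS M T x -> small M [set: I] ->
  (forall i, x < b i) -> exists2 c, c < x &
  forall i a, c <= a -> a < x -> walk a (b i) = steps x (b i) ++ walk a x.
Proof.
move=> Sx sI xb.
have /choice[c cP] : forall i, exists c, c < x /\
    forall a, c <= a -> a < x -> walk a (b i) = steps x (b i) ++ walk a x.
  by move=> i; have [c cx cP] := pass1 Sx (xb i); exists c.
have [c0 c0x c0P] := cofS_bound Sx sI (fun i _ => (cP i).1).
exists c0 => // i a c0a ax; apply: (cP i).2 => //.
by apply: le_trans c0a; apply/ltW; exact: c0P.
Qed.

End Walks.

(** * Restrictions of well-orders *)

Section Restriction.
Context {d : Order.disp_t} {T : orderType d}.
Variable P : pred T.

Definition subord := {x : T | P x}.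
HB.instance Definition _ := SubChoice.on subord.
HB.instance Definition _ := [SubChoice_isSubOrder of subord by <: with d].

Lemma subord_wo : well_order (<=%O : rel T) -> well_order (<=%O : rel subord).
Proof.
move=> wo; apply: antisymmetric_well_order; first exact: le_anti.
move=> A [x Ax].
have [|z [y [Ay <-]] zm] := wo_min wo (P := fun t => exists y : subord, y \in A /\ val y = t).
  by exists (val x), x.
by exists y; split=> // u Au; apply: zm; exists u.
Qed.

Lemma card_subord (A : set subord) : A #<= val @` A.
Proof.
apply/card_leE; exists (fun x t => val x = t); split.
  by move=> x Ax; exists (val x) => //; exists x.
by move=> x y t _ _ <- /val_inj.
Qed.

End Restriction.
Arguments subord {d T} P.

(** The least segment exceeding [del] would itself be a cardinal larger than [del], so [lam] would
    inject into one of its own proper segments. *)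
Lemma succ_card_seg (del lam : cardinal) : is_succ_card del lam ->
  forall x : lam, [set y | y < x] #<= [set: del].
Proof.
move=> [_ lmin] x0; apply: contrapT => N0.
have [x N xmin] := wo_min (card_wo (c := lam)) (ex_intro (fun x : lam => ~ ([set y | y < x] #<= [set: del])) _ N0).
have segE : [set: subord (fun y : lam => y < x)] #<= [set y | y < x].
  by apply: card_le_trans (card_subord _) _; apply: subset_card_le => _ [[y yx] _ <-].
have segE' : [set y | y < x] #<= [set: subord (fun y : lam => y < x)].
  apply/card_leE; exists (fun y z => val z = y); split=> [y yx|y y' z _ _ <- <-//].
  by exists (exist _ y yx).
have ini (b : subord (fun y : lam => y < x)) :
    ~~ ([set: subord (fun y : lam => y < x)] #<= [set z | z < b]).
  apply/negP => H; apply: N; apply: card_le_trans segE' _; apply: card_le_trans H _.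
  apply: card_le_trans (card_subord _) _.
  suff bd : [set y | y < val b] #<= [set: del].
    by apply: card_le_trans bd; apply: subset_card_le => _ [z zb <-].
  apply: contrapT => /xmin; rewrite leNgt => /negP; apply; exact: (valP b).
pose k := Cardinal (subord_wo (P := fun y : lam => y < x) (card_wo (c := lam))) ini.
have : cle lam k.
  apply: lmin; split; last by move=> H; apply: N; exact: card_le_trans segE' H.
  apply: card_le_trans segE'; apply: contrapT => /card_cmp[m H]; apply: N.
  by apply: card_le_trans H _; exact: card_leT.
move=> H; have := @card_initial lam x; apply/negP/negPn.
exact: card_le_trans H segE.
Qed.

(** * The successor of [th0] inside [th1] *)

Section SuccessorInside.
Variables th0 th1 : cardinal.
Hypothesis lt01 : clt th0 th1.

Definition succ_in := subord (fun x : th1 => [set y | y < x] #<= [set: th0]).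

Lemma succ_in_wo : well_order (<=%O : rel succ_in).
Proof. exact: subord_wo (card_wo (c := th1)). Qed.

Lemma succ_in_seg (x : succ_in) : [set y | y < x] #<= [set: th0].
Proof.
apply: card_le_trans (card_subord _) _; apply: card_le_trans (valP x).
by apply: subset_card_le => _ [y yx <-].
Qed.

Lemma succ_in_le : [set: succ_in] #<= [set: th1].
Proof. by apply: card_le_trans (card_subord _) _; exact: card_leT. Qed.

(** If some segment of [th1] exceeds [th0], the least such one lies inside [succ_in]; otherwise
    [succ_in] is all of [th1]. *)
Lemma succ_in_big : ~ ([set: succ_in] #<= [set: th0]).
Proof.
move=> H.
have sub (A : set th1) : (forall x, A x -> [set y | y < x] #<= [set: th0]) ->
    A #<= [set: th0].
  move=> AP; apply: card_le_trans H; apply/card_leE.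
  exists (fun x (z : succ_in) => val z = x); split=> [x Ax|x x' z _ _ <- <-//].
  by exists (exist _ x (AP _ Ax)).
have [[x0 N0]|N] := pselect (exists x : th1, ~ ([set y | y < x] #<= [set: th0])).
  have [x Nx xmin] := wo_min (card_wo (c := th1))
    (ex_intro (fun x : th1 => ~ ([set y | y < x] #<= [set: th0])) _ N0).
  apply: Nx; apply: sub => y yx; apply: contrapT => /xmin; rewrite leNgt.
  by move=> /negP; exact.
apply: lt01.2; apply: sub => x _; apply: contrapT => Nx; apply: N.
by exists x.
Qed.

End SuccessorInside.

(** * Decoding *)

Lemma seq_argmax (U : eqType) d (O : orderType d) (f : U -> O) (P : pred U) s :
  has P s -> exists x, [/\ x \in s, P x & forall y, y \in s -> P y -> f y <= f x].
Proof.
elim: s => //= z s IH.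
have [/IH[x [xs Px xm]] _|/hasPn N] := boolP (has P s); last first.
  rewrite orbF => Pz; exists z; split; rewrite ?mem_head // => y.
  by rewrite in_cons => /orP[/eqP->//|/N/negP].
have [/andP[Pz xz]|N] := boolP (P z && (f x <= f z)).
  exists z; split; rewrite ?mem_head // => y; rewrite in_cons => /orP[/eqP->//|ys Py].
  by apply: le_trans xz; exact: xm.
exists x; split; rewrite ?in_cons ?xs ?orbT // => y /orP[/eqP-> Pz|]; last exact: xm.
by move: N; rewrite Pz /= -ltNge => /ltW.
Qed.

Section Top.
Context {d1 d2 : Order.disp_t} {L : orderType d1} {H : orderType d2}.
Variable h : L -> H.

(** The suffix starting at the first entry of maximal [h]. *)
Definition top (w : seq L) : seq L :=
  drop (find (fun z => all (fun y => h y <= h z) w) w) w.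

(** Only [v] has entries with [h] at least [i], so the maximum over the whole list is attained in
    [v] alone. *)
Lemma top_cat (i : H) (u v r : seq L) :
  {in u, forall y, h y < i} -> {in r, forall y, h y < i} ->
  (exists2 z, z \in v & i <= h z) -> top (u ++ v ++ r) = top v ++ r.
Proof.
move=> hu hr [z zv iz]; rewrite /top.
set p := (fun z => all _ (u ++ v ++ r)); set q := (fun z => all _ v).
have qv : has q v.
  have [|x [xv _ xm]] := @seq_argmax _ _ _ h predT v; first by apply/hasP; exists z.
  by apply/hasP; exists x => //; apply/allP => y yv; exact: xm.
have pq : {in v, p =1 q}.
  move=> x xv; rewrite /p /q !all_cat.
  have [/allP a|_] := boolP (all _ v); last by rewrite /= andbF.
  have ix : i <= h x by apply: le_trans iz _; exact: a.
  rewrite andTb; apply/andP; split; apply/allP => y.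
    by move=> /hu yi; apply/ltW/(lt_le_trans yi).
  by move=> /hr yi; apply/ltW/(lt_le_trans yi).
have nu : ~~ has p u.
  apply/hasPn => x /hu xi; apply/negP => /allP/(_ z).
  rewrite !mem_cat zv orbT => /(_ isT) zx.
  by have := le_lt_trans (le_trans iz zx) xi; rewrite ltxx.
rewrite find_cat (negbTE nu) find_cat (_ : has p v = has q v); last exact: eq_in_has.
rewrite qv drop_cat ltnNge leq_addr /= addKn drop_cat.
rewrite (eq_in_find pq).
by rewrite -has_find qv.
Qed.

End Top.

Fixpoint before (U : eqType) (s : seq U) (x y : U) : bool :=
  if s is z :: t then (x == z) && (y \in t) || before t x y else false.

Lemma before_mem (U : eqType) (s : seq U) x y :
  before s x y -> x \in s /\ y \in s.
Proof.
elim: s => //= z s IH /orP[/andP[/eqP-> ys]|/IH[xs ys]].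
  by rewrite mem_head in_cons ys orbT.
by rewrite !in_cons xs ys !orbT.
Qed.

Lemma before_cat (U : eqType) (s t : seq U) x y : before (s ++ t) x y =
  [|| before s x y, (x \in s) && (y \in t) | before t x y].
Proof.
elim: s => [|z s IH] //=; rewrite IH mem_cat in_cons.
by case: (x == z); case: (y \in s); case: (y \in t); case: (x \in s);
  case: (before s x y); case: (before t x y).
Qed.

Section Decoder.
Context {d : Order.disp_t} {K : orderType d} {M : cardinal}.
Variables (rho : K -> K -> M) (label : K -> nat).

Definition maxpair (s : seq K) (x y : K) : Prop :=
  [/\ before s x y, x < y &
    forall x' y', before s x' y' -> x' < y' -> rho x' y' <= rho x y].

Definition code (s : seq K) (j : K) : Prop :=
  exists x, [/\ maxpair s x j, (forall x' y', maxpair s x' y' -> x' <= x) &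
    forall y, maxpair s x y -> j <= y].

Definition dec (s : seq K) : nat :=
  pickd 0%N (fun n => exists2 j, code s j & n = label j).

Lemma dec_code s j : code s j -> dec s = label j.
Proof.
move=> cj.
have [j' [x' [m' l' u']] ->] : exists2 j', code s j' & dec s = label j'.
  by apply: (@pickdP _ 0%N (fun n => exists2 j, code s j & n = label j));
    exists (label j), j.
case: cj => x [m l u].
have xx' : x = x' by apply/eqP; rewrite eq_le (l' _ _ m) (l _ _ m').
rewrite -xx' in m' u'.
by congr label; apply/eqP; rewrite eq_le (u _ m') (u' _ m).
Qed.

Hypothesis rho_sub1 : forall x y z, x < y -> y < z ->
  rho x z <= Order.max (rho x y) (rho y z).
Hypothesis rho_sub2 : forall x y z, x < y -> y < z ->
  rho x y <= Order.max (rho x z) (rho y z).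

(** Here [l] lists the tags above the wanted node and [r] those from it downwards. As [rho k j]
    exceeds all values inside [l] and inside [r], only pairs across can be maximal. *)
Lemma dec_cat (l r : seq K) (k j u : K) (e f : M) :
  k \in l -> j \in r -> u <= k -> k < j -> e < rho k j -> f < rho k j ->
  {in l &, forall x y, x < y -> rho x y <= e} ->
  {in l, forall x, x < j \/ {in r, forall y, y < x}} ->
  {in r &, forall x y, x < y -> rho x y <= f} ->
  {in r, forall y, y < j -> y < u} ->
  dec (l ++ r) = label j.
Proof.
move=> kl jr uk kj ekj fkj le_ lj rf ru.
have [|x0 [x0l x0j x0m]] := @seq_argmax _ _ _ (rho^~ j) (fun x => x < j) l.
  by apply/hasP; exists k.
(* Among the left ends maximising [rho] against [j], take the largest. *)
have [|x [xl /andP[xj /eqP xE] xm]] :=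
    @seq_argmax _ _ _ id (fun x => (x < j) && (rho x j == rho x0 j)) l.
  by apply/hasP; exists x0 => //; rewrite x0j eqxx.
have {x0m} xA y : y \in l -> y < j -> rho y j <= rho x j by rewrite xE; exact: x0m.
have {xm x0 x0l x0j xE} xm y : y \in l -> y < j -> rho y j = rho x j -> y <= x.
  by move=> yl yj yE; apply: xm => //; rewrite yj yE xE eqxx.
have kA := xA _ kl kj.
have eA : e < rho x j by apply: lt_le_trans kA.
have fA : f < rho x j by apply: lt_le_trans kA.
(* Replacing the right end [z] by [j] costs at most [f]: use [rho_sub2] if [z < j] and [rho_sub1] if
   [j < z]. *)
have cross y z : y \in l -> z \in r -> y < z -> y < j /\ rho y z <= Order.max (rho y j) f.
  move=> yl zr yz; have yj : y < j.
    by case: (lj _ yl) => // /(_ _ zr) zy; have := lt_trans yz zy; rewrite ltxx.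
  split=> //; have [zj|jz|->] := ltgtP z j; last by rewrite le_max lexx.
    apply: le_trans (rho_sub2 yz zj) _; rewrite ge_max !le_max lexx /=.
    by rewrite (rf _ _ zr jr zj) orbT.
  apply: le_trans (rho_sub1 yj jz) _; rewrite ge_max !le_max lexx /=.
  by rewrite (rf _ _ jr zr jz) orbT.
have pairs y z : before (l ++ r) y z -> y < z -> rho y z <= rho x j /\
    (rho y z = rho x j -> [/\ y \in l, z \in r, y < j & rho y j = rho x j]).
  rewrite before_cat => /or3P[/before_mem[yl zl]|/andP[yl zr]|/before_mem[yr zr]] yz.
  - have yze := le_lt_trans (le_ _ _ yl zl yz) eA.
    by split=> [|E]; [exact: ltW|move: yze; rewrite E ltxx].
  - have [yj yzf] := cross _ _ yl zr yz; split.
      by apply: le_trans yzf _; rewrite ge_max xA // ltW.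
    move=> E; split=> //; apply/eqP; rewrite eq_le xA //=.
    by move: yzf; rewrite E le_max [X in _ || X]leNgt fA orbF.
  - have yzf := le_lt_trans (rf _ _ yr zr yz) fA.
    by split=> [|E]; [exact: ltW|move: yzf; rewrite E ltxx].
have mp : maxpair (l ++ r) x j.
  split=> // [|y z yz_ yz]; last exact: (pairs _ _ yz_ yz).1.
  by rewrite before_cat xl jr orbT.
have eqA y z : maxpair (l ++ r) y z -> [/\ y \in l, z \in r, y < j & rho y j = rho x j].
  move=> [yz_ yz ym]; apply: (pairs _ _ yz_ yz).2; apply/eqP; rewrite eq_le.
  by rewrite (pairs _ _ yz_ yz).1 ym //; case: mp.
(* If [x < k], subadditivity through [k] makes [rho k j] maximal too, against the choice of [x]. *)
have kx : k <= x.
  rewrite leNgt; apply/negP => xk.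
  have := rho_sub1 xk kj; rewrite le_max [X in X || _]leNgt.
  rewrite (le_lt_trans (le_ _ _ xl kl xk) eA) /= => xkj.
  have : k <= x by apply: xm => //; apply/eqP; rewrite eq_le kA xkj.
  by rewrite leNgt xk.
apply: dec_code; exists x; split=> // [y z /eqA[yl _ yj yE]|y my]; first exact: xm.
(* A right end [y < j] would satisfy [y < u <= k <= x], so the pair would not be increasing. *)
have [_ yr _ _] := eqA _ _ my; rewrite leNgt; apply/negP => yj.
have [_ xy _] := my; have := lt_trans xy (ru _ yr yj).
by rewrite ltNge (le_trans uk kx).
Qed.

End Decoder.

(** * The colouring *)

Lemma stat_fix (M : cardinal) d (T : orderType d) (regM : regular M)
    (segT : forall x : T, [set y | y < x] #<= [set: M])
    (bigT : ~ ([set: T] #<= [set: M])) (A : set T) (Q : T -> T -> Prop) :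
  stat A -> (forall x, A x -> exists2 c, c < x & Q x c) ->
  exists c, stat [set x | [/\ A x, c < x & Q x c]].
Proof.
move=> sA H.
have /choice[f fP] : forall x, exists c, A x -> c < x /\ Q x c.
  move=> x; have [Ax|N] := pselect (A x); last by exists x.
  by have [c cx Qc] := H _ Ax; exists c.
have [c sc] := fodor regM segT bigT (f := f) sA (fun x Ax => (fP x Ax).1).
exists c; apply: stat_sub sc => x [Ax <-]; have [] := fP _ Ax.
by split.
Qed.

Lemma small_prod (M : cardinal) (A B : Type) : regular M ->
  small M [set: A] -> small M [set: B] -> small M [set: A * B].
Proof.
move=> regM sA sB.
apply: (small_le _ (small_bigcup (B := fun a => [set p : A * B | p.1 = a]) regM sA _)).
  by apply: subset_card_le => -[a b] _; exists a.
move=> a _; apply: (small_le _ sB); apply/card_leE; exists (fun p b => p.2 = b).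
split=> [p _|p p' b /= E E' Eb Eb']; first by exists p.2.
by case: p p' E E' Eb Eb' => ? ? [? ?] /= -> -> -> ->.
Qed.

Lemma small_below (k : cardinal) (b : k) : small k [set: below b].
Proof.
apply: (small_le _ (@small_lt k b)); apply/card_leE.
exists (fun x y => sval x = y); split=> [[x xb] _|x y z _ _ <- /val_inj//].
by exists x.
Qed.

(** By injectivity at most [del] many blocks have an entry at or below [x], so all blocks beyond
    some bound lie above [x]. *)
Lemma next_block (lam del : cardinal) (I : Type) (z : lam * I -> lam) :
  regular del -> (forall x : lam, [set y | y < x] #<= [set: del]) ->
  ~ ([set: lam] #<= [set: del]) -> injective z ->
  forall x, exists2 a, x < a & forall i, x < z (a, i).
Proof.
move=> regD segL bigL zI x.
have [|c cP] := @succ_bound_set del regD _ lam segL bigL [set a | exists i, z (a, i) <= x].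
  apply: card_le_trans (succ_ge regD segL bigL x); apply/card_leE.
  exists (fun a y => exists i, z (a, i) = y); split=> [a [i ai]|a a' y _ _ [i <-] [i' /zI[]//]].
  by exists (z (a, i)) => //; exists i.
have [a] := succ_gt regD segL bigL (Order.max c x).
rewrite gt_max => /andP[ca xa]; exists a => // i; rewrite ltNge; apply/negP => ax.
have /cP : exists i, z (a, i) <= x by exists i.
by rewrite ltNge (ltW ca).
Qed.

(* Otherwise every initial segment of [K] could be enlarged so as to catch one
   more entry of [l i] for all large [i], although [l i] has length [q]. *)
Lemma left_stable (th0 th1 : cardinal) d (K : orderType d) (rho : K -> K -> th0)
    (l : th1 -> seq K) : regular th0 -> regular th1 -> clt th0 th1 ->
  (exists x : K, True) ->
  exists (q : nat) (e : th0) (b : K), forall (v : K) (i0 : th1), exists i, [/\ i0 < i,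
    size (l i) = q, {in l i &, forall x y, x < y -> rho x y <= e} &
    {in l i, forall x, x <= b \/ v < x}].
Proof.
move=> reg0 reg1 lt01 [w _].
have s01 : small th1 [set: th0] := lt01.2.
have sn1 : small th1 [set: nat] by apply: (small_le _ s01); exact: reg0.1.
have [|i|[q e] good] := @pigeon _ th1 setT (nat * th0)%type (fun i p => size (l i) = p.1 /\
    {in l i &, forall x y, x < y -> rho x y <= p.2}).
- move=> f _; have [m mP] := reg_bound reg1 f (small_prod reg1 sn1 s01).
  by exists m => // p; apply/ltW; exact: mP.
- move=> _; exists i; split=> //.
  have [e eP] := reg_seq_bound reg0 [seq (x, y) | x <- l i, y <- l i] (fun p => rho p.1 p.2).
  exists (size (l i), e); split=> // x y xl yl _; apply/ltW.
  by apply: (eP (x, y)); apply/allpairsP; exists (x, y).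
exists q, e; apply: contrapT => N.
have step (x : K) : exists v i0, forall i, i0 < i -> size (l i) = q ->
    {in l i &, forall x y, x < y -> rho x y <= e} -> exists2 y, y \in l i & x < y <= v.
  apply: contrapT => Nx; apply: N; exists x => v i0; apply: contrapT => Nv.
  apply: Nx; exists v, i0 => i i0i si ri; apply: contrapT => Ni; apply: Nv.
  exists i; split=> // y yl; have [yx|xy] := leP y x; [by left|right].
  by rewrite ltNge; apply/negP => yv; apply: Ni; exists y => //; rewrite xy.
have many n : exists (x : K) (i0 : th1), forall i, i0 < i -> size (l i) = q ->
    {in l i &, forall x y, x < y -> rho x y <= e} ->
    (n <= count (fun y => (y <= x)%O) (l i))%N.
  elim: n => [|n [x [i0 IH]]].
    by have [i0 _] := reg_inhabited reg1; exists w, i0.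
  have [v [i1 vP]] := step x; exists v, (Order.max i0 i1) => i.
  rewrite gt_max => /andP[i0i i1i] si ri; have [y yl /andP[xy yv]] := vP i i1i si ri.
  apply: leq_ltn_trans (IH i i0i si ri) _.
  have sub : subpred (fun y : K => y <= x) (fun y => y <= v).
    by move=> t tx; apply: le_trans tx _; apply: le_trans (ltW xy) yv.
  elim: (l i) yl => //= t s IHs; rewrite in_cons => /orP[/eqP <-|/IHs H].
    by rewrite yv leNgt xy /= add0n add1n ltnS; exact: sub_count.
  rewrite -addnS; apply: leq_add => //.
  by case: (boolP (t <= x)) => // /sub ->.
have [x [i0 H]] := many q.+1; have [i1 i01] := reg_gt reg1 i0.
have [i [_ i1i [si ri]]] := good i1 Logic.I.
have := H i (lt_le_trans i01 i1i) si ri.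
by rewrite ltnNge -[q]/((q, e).1) -si count_size.
Qed.

(** * The walks above and below [x], and the monochromatic rectangle *)

Section Verify.
Variables del th0 th1 lam : cardinal.
Hypotheses (regD : regular del) (reg0 : regular th0) (reg1 : regular th1).
Hypotheses (lt1D : clt th1 del) (lt01 : clt th0 th1).
Let K := succ_in th0 th1.
Hypothesis segL : forall x : lam, [set y | y < x] #<= [set: del].
Hypothesis bigL : ~ ([set: lam] #<= [set: del]).

Let woL := card_wo (c := lam).
Let woK : well_order (<=%O : rel K) := @succ_in_wo th0 th1.
Let segK := @succ_in_seg th0 th1.
Let bigK : ~ ([set: K] #<= [set: th0]) := succ_in_big lt01.

Let s1D : small del [set: th1] := lt1D.2.
Let sKD : small del [set: K].
Proof. exact: small_le (@succ_in_le th0 th1) s1D. Qed.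
Let s01 : small th1 [set: th0] := lt01.2.
Let s0D : small del [set: th0].
Proof. exact: small_le lt01.1 s1D. Qed.

Variable e : lam -> lam -> del.
Hypothesis eI : forall b x y, x < b -> y < b -> e b x = e b y -> x = y.
Variable rho : K -> K -> th0.
Hypothesis rho_sub1 : forall x y z, x < y -> y < z ->
  rho x z <= Order.max (rho x y) (rho y z).
Hypothesis rho_sub2 : forall x y z, x < y -> y < z ->
  rho x y <= Order.max (rho x z) (rho y z).
Hypothesis rho_small : forall y n, small th0 [set x | x < y /\ rho x y <= n].
Variables (h : lam -> th1) (k : lam -> K) (g : lam -> lam) (label : K -> nat).
Local Notation S := (cofS del lam).
Hypothesis hstat : forall i, stat [set x | S x /\ h x = i].
Hypothesis kstat : forall i, stat [set x | S x /\ k x = i].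
Hypothesis gstat : forall i, stat [set x | S x /\ g x = i].
Hypothesis lstat : forall n, stat [set x | cofS th0 K x /\ label x = n].

Local Notation walk := (walk e).
Local Notation steps := (steps e).

Definition colour (a b : lam) : lam :=
  let s := top h (walk a b) in g (nth b s (dec rho label (map k s))).

Variables (I0 I1 : Type).
Hypotheses (sI0 : small th0 [set: I0]) (sI1 : small th1 [set: I1]).
Variables (z0 : lam * I0 -> lam) (z1 : lam * I1 -> lam).
Hypotheses (z0I : injective z0) (z1I : injective z1).

Let sI1D : small del [set: I1].
Proof. exact: small_le (small_card_le sI1) s1D. Qed.
Let sI01 : small th1 [set: I0].
Proof. exact: small_le (small_card_le sI0) s01. Qed.

(** The walks from a block above [x] to points of [[c, x)] split into a part [u i] of each entry's
    own, a common part [V], and the walk from [x]. *)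
Definition above (m : th1) (x c : lam) (V : seq lam) : Prop :=
  exists (a : lam) (u : I1 -> seq lam), [/\ x < a, forall i, x < z1 (a, i),
    forall i, {in u i, forall y, h y < m} &
    forall i y, c <= y -> y < x -> walk y (z1 (a, i)) = u i ++ V ++ walk y x].

Lemma above_ext m x x1 c c1 V : x < x1 ->
  (forall a, c1 <= a -> a < x -> walk a x1 = steps x x1 ++ walk a x) ->
  above m x1 c V -> above m x (Order.max c c1) (V ++ steps x x1).
Proof.
move=> xx1 H [a [u [x1a x1z uh uw]]]; exists a, u; split=> // [|i|i y].
- exact: lt_trans x1a.
- exact: lt_trans (x1z i).
- rewrite ge_max => /andP[cy c1y] yx; rewrite uw ?H -?catA //.
  exact: lt_trans xx1.
Qed.

Lemma above_mono m x c c' V : c <= c' -> above m x c V -> above m x c' V.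
Proof.
move=> cc' [a [u [H1 H2 H3 H4]]]; exists a, u; split=> // i y c'y yx.
by apply: H4 => //; exact: le_trans c'y.
Qed.

(** The walks from one block down to [x] are finite and fewer than [th1], which bounds their
    [h]-tags; Fodor's lemma fixes [c] and [stat_union] fixes [m]. *)
Lemma above_base : exists m c, stat [set x | S x /\ above m x c [::]].
Proof.
have [||c] := @stat_fix del _ lam regD segL bigL S (fun x c => exists m, above m x c [::]).
- exact: stat_cofS.
- move=> x Sx; have [a xa xz] := next_block regD segL bigL z1I x.
  have [c cx cP] := pass regD woL eI Sx sI1D xz; exists c => //.
  have /choice[mi miP] : forall i, exists m, forall y, y \in steps x (z1 (a, i)) -> h y < m.
    by move=> i; exact: (reg_seq_bound reg1).
  have [m mP] := reg_bound reg1 mi sI1.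
  exists m, a, (fun i => steps x (z1 (a, i))); split=> // i y ys.
  by apply: lt_trans (miP _ _ ys) _; exact: mP.
move=> sc; have [||m sm] := stat_union regD segL bigL (B := fun m => [set x | above m x c [::]]) sc.
- exact: lt1D.1.
- by move=> x [_ _ [m am]]; exists m.
exists m, c; apply: stat_sub sm => x [[Sx _ _] am].
by split.
Qed.

(** Descend from a point [x1] given by [above_base] to a smaller [x] with [h x = i]. Fodor's lemma
    fixes [c] for each [i], and these are bounded over all [i]. *)
Lemma above_h : exists m c, forall i : th1,
  stat [set x | [/\ S x, h x = i & exists V, above m x c V]].
Proof.
have [m [c0 st]] := above_base.
have /choice[c1 c1P] : forall i : th1, exists c, stat [set x |
    [/\ S x /\ h x = i, c < x & exists V, above m x c V]].
  move=> i; have [||c sc] := @stat_fix del _ lam regD segL bigL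
      [set x | (S x /\ h x = i) /\ c0 < x] (fun x c => exists V, above m x c V).
  - exact: stat_gt (hstat i).
  - move=> x [[Sx hx] c0x]; have [x1 [[_ ax1] xx1 _]] := st id x.
    have [c cx cP] := pass1 regD woL eI Sx xx1.
    exists (Order.max c0 c); first by rewrite gt_max c0x.
    by exists ([::] ++ steps x x1); exact: above_ext.
  - by exists c; apply: stat_sub sc => x [[? _] ? ?]; split.
have [c cP] := succ_bound regD segL bigL c1 lt1D.1.
exists m, c => i; apply: stat_sub (c1P i) => x [[Sx hx] _ [V aV]].
by split=> //; exists V; apply: above_mono aV; apply/ltW; exact: cP.
Qed.

(** Over the same [x], the points [x1] of [above_h] enter [V] as nodes of [h]-tag [i], one for each
    [i]. As [th1] is less than [del], the cofinality of [x] gives a common [c]. *)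
Lemma above_k : exists m c, forall j : K, stat [set x | [/\ S x, k x = j &
  forall i : th1, exists2 V, exists2 z, z \in V & h z = i & above m x c V]].
Proof.
have [m [c0 st]] := above_h.
have /choice[c1 c1P] : forall j : K, exists c, stat [set x | [/\ S x /\ k x = j, c < x &
    forall i : th1, exists2 V, exists2 z, z \in V & h z = i & above m x c V]].
  move=> j; have [||c sc] := @stat_fix del _ lam regD segL bigL
      [set x | (S x /\ k x = j) /\ c0 < x] (fun x c =>
      forall i : th1, exists2 V, exists2 z, z \in V & h z = i & above m x c V).
  - exact: stat_gt (kstat j).
  - move=> x [[Sx kx] c0x].
    have /choice[ci ciP] : forall i : th1, exists c, c < x /\
        exists2 V, exists2 z, z \in V & h z = i & above m x c V.
      move=> i; have [x1 [[_ hx1 [V aV]] xx1 _]] := st i id x.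
      have [c cx cP] := pass1 regD woL eI Sx xx1.
      exists (Order.max c0 c); split; first by rewrite gt_max c0x.
      exists (V ++ steps x x1); last exact: above_ext.
      by exists x1 => //; rewrite mem_cat steps_head ?orbT.
    have [c cx cP] := cofS_bound Sx s1D (fun i _ => (ciP i).1).
    exists c => // i; have [_ [V zV aV]] := ciP i; exists V => //.
    by apply: above_mono aV; apply/ltW; exact: cP.
  - by exists c; apply: stat_sub sc => x [[? _] ? ?]; split.
have [c cP] := succ_bound regD segL bigL c1 (small_card_le sKD).
exists m, c => j; apply: stat_sub (c1P j) => x [[Sx hx] _ H].
split=> // i; have [V zV aV] := H i; exists V => //.
by apply: above_mono aV; apply/ltW; exact: cP.
Qed.

(** Now a point [x1] of [above_k] enters as a node of [k]-tag [j]. The part [Q] from it down to [x]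
    depends on [j] and not on [i], so [i] can later exceed the [h]-tags of [Q]. *)
Lemma upper : exists m c0, forall x, S x -> c0 < x -> exists2 c, c < x &
  forall j : K, exists2 Q, j \in map k Q & forall i : th1,
    exists2 V, exists2 z, z \in V & h z = i & above m x c (V ++ Q).
Proof.
have [m [c0 st]] := above_k; exists m, c0 => x Sx c0x.
have /choice[cj cjP] : forall j : K, exists c, c < x /\
    exists2 Q, j \in map k Q & forall i : th1,
    exists2 V, exists2 z, z \in V & h z = i & above m x c (V ++ Q).
  move=> j; have [x1 [[_ kx1 HV] xx1 _]] := st j id x.
  have [c cx cP] := pass1 regD woL eI Sx xx1.
  exists (Order.max c0 c); split; first by rewrite gt_max c0x.
  exists (steps x x1); first by apply/mapP; exists x1 => //; exact: steps_head.
  by move=> i; have [V zV aV] := HV i; exists V => //; exact: above_ext.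
have [c cx cP] := cofS_bound Sx sKD (fun j _ => (cjP j).1).
exists c => // j; have [_ [Q jQ HQ]] := cjP j; exists Q => // i.
have [V zV aV] := HQ i; exists V => //.
by apply: above_mono aV; apply/ltW; exact: cP.
Qed.

(* The components of [p] bound, in this order, the [h]-tags, the [k]-tags less
   than [j], all [k]-tags, and the values of [rho]. *)
Definition below_at (x : lam) (j : K) (p : th1 * K * K * th0) (c : lam) : Prop :=
  exists a, [/\ a < x, p.1.1.2 < j & forall i, [/\ c <= z0 (a, i), z0 (a, i) < x &
    let s := walk (z0 (a, i)) x in [/\ j \in map k s,
      {in s, forall y, h y < p.1.1.1},
      {in map k s, forall y, y < j -> y < p.1.1.2},
      {in map k s, forall y, y < p.1.2} &
      {in map k s &, forall y y', y < y' -> rho y y' <= p.2}]]].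

(** Closure under [F] places between [c] and [x] a node [y] of [k]-tag [j] with a whole block below
    it, whose walks from [x] pass through [y]. The bounds exist since a block has fewer than [th0]
    entries; the one on tags less than [j] uses the cofinality of [j]. *)
Lemma lower : exists F : lam -> lam, forall x, S x ->
  (forall y, y < x -> F y < x) -> forall j, cofS th0 K j ->
  exists p, forall c, c < x -> below_at x j p c.
Proof.
have /choice[nb nbP] : forall x, exists a, x < a /\ forall i, x < z0 (a, i).
  by move=> x; have [a xa xz] := next_block regD segL bigL z0I x; exists a.
have sI0D : small del [set: I0] by exact: small_le (small_card_le sI0) s0D.
have /choice[Fa FaP] : forall x, exists c, nb x < c /\ forall i, z0 (nb x, i) < c.
  move=> x; have [c cP] := succ_bound regD segL bigL (fun i => z0 (nb x, i)) (small_card_le sI0D).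
  have [c' c'P] := succ_gt regD segL bigL (nb x).
  by exists (Order.max c c'); rewrite lt_max c'P orbT; split=> // i; rewrite lt_max cP.
have /choice[yy yyP] : forall p : K * lam, exists y,
    [/\ S y, k y = p.1, p.2 < y & forall t, t < y -> Fa t < y].
  by move=> [j c]; have [y [[Sy ky] cy yF]] := kstat j Fa c; exists y.
have /choice[F FP] : forall c, exists b, forall j, yy (j, c) < b.
  move=> c; have [b bP] := succ_bound regD segL bigL (fun j => yy (j, c)) (small_card_le sKD).
  by exists b => j; exact: bP.
exists F => x Sx xF j Sj.
have ex c : c < x -> exists p, below_at x j p c.
  move=> cx; have [Sy ky cy yF] := yyP (j, c); set y := yy (j, c) in Sy ky cy yF.
  have yx : y < x by apply: lt_trans (FP c j) _; exact: xF.
  have [b bY bP] := pass1 regD woL eI Sy yx.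
  pose c' := Order.max b c; pose a := nb c'.
  have c'y : c' < y by rewrite gt_max bY.
  have ay : a < y by apply: lt_trans (FaP c').1 _; exact: yF.
  have azy i : z0 (a, i) < y by apply: lt_trans ((FaP c').2 i) _; exact: yF.
  have c'z i : c' < z0 (a, i) by exact: (nbP c').2.
  pose w i := walk (z0 (a, i)) x.
  have /choice[hi hiP] : forall i, exists m, forall y, y \in w i -> h y < m.
    by move=> i; exact: (reg_seq_bound reg1).
  have [m mP] := reg_bound reg1 hi sI01.
  have /choice[ui uiP] : forall i, exists u, u < j /\
      forall t, t \in map k (w i) -> t < j -> t < u.
    move=> i; have [|t [_ //]|u uj uP] := Sj [set t | t \in map k (w i) /\ t < j].
      apply: (small_finite reg0); apply: (sub_finite_set (B := [set` map k (w i)])).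
        by move=> t [].
      exact: finite_seq.
    by exists u; split=> // t tw tj; exact: uP.
  have [u uj uP] := cofS_bound Sj sI0 (fun i _ => (uiP i).1).
  have /choice[vi viP] : forall i, exists v, forall t, t \in map k (w i) -> t < v.
    move=> i; have [|v vP] := @succ_bound_set th0 reg0 _ K segK bigK [set` map k (w i)].
      by apply: card_le_trans reg0.1; apply: finite_set_countable; exact: finite_seq.
    by exists v.
  have [v vP] := succ_bound reg0 segK bigK vi (small_card_le sI0).
  have /choice[fi fiP] : forall i, exists n, forall t t', t \in map k (w i) ->
      t' \in map k (w i) -> rho t t' < n.
    move=> i; have [n nP] := reg_seq_bound reg0
      [seq (t, t') | t <- map k (w i), t' <- map k (w i)] (fun p => rho p.1 p.2).
    by exists n => t t' tw tw'; apply: (nP (t, t')); apply/allpairsP; exists (t, t').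
  have [n nP] := reg_bound reg0 fi sI0.
  exists (m, u, v, n), a; split=> // [|i]; first exact: lt_trans yx.
  split.
  - by move: (c'z i); rewrite gt_max => /andP[_ /ltW].
  - exact: lt_trans (azy i) yx.
  rewrite -/(w i) /=; split.
  - rewrite /w bP //; last by apply/ltW; move: (c'z i); rewrite gt_max => /andP[].
    by rewrite map_cat mem_cat walk_cons // /= in_cons ky eqxx orbT.
  - by move=> t tw; apply: lt_trans (hiP _ _ tw) _; exact: mP.
  - by move=> t tw tj; apply: lt_trans ((uiP i).2 _ tw tj) _; exact: uP.
  - by move=> t tw; apply: lt_trans (viP _ _ tw) _; exact: vP.
  - by move=> t t' tw tw' _; apply/ltW/(lt_trans (fiP _ _ _ tw tw')); exact: nP.
(* There are fewer than [del] values of [p], so one of them serves cofinally many [c < x], hence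
   all. *)
have [|c cx|p pP] := @pigeon _ lam [set c | c < x] _ (fun c p => below_at x j p c).
- move=> f fx; have [|b bx bP] := @cofS_bound del _ lam x _ setT f Sx _ (fun i _ => fx i).
    by do 3 (apply: (small_prod regD) => //).
  by exists b => // p; apply/ltW; exact: bP.
- by have [p pP] := ex c cx; exists c; split=> //; exists p.
exists p => c cx; have [c' [_ cc' [a [ax uj aP]]]] := pP c cx.
exists a; split=> // i; have [c'z zx H] := aP i; split=> //.
exact: le_trans c'z.
Qed.

(** The choices are made in the order [x], [q], [j], [kk], [i], each against bounds fixed before. *)
Lemma colour_rectangle (gam : lam) : exists a0 a1 : lam, a0 < a1 /\
  forall i0 i1, z0 (a0, i0) < z1 (a1, i1) /\
    colour (z0 (a0, i0)) (z1 (a1, i1)) = gam.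
Proof.
have [m [c0 up]] := upper; have [F low] := lower.
have [x [[Sx gx] c0x xF]] := gstat gam F c0.
have [c cx HQ] := up _ Sx c0x.
have /choice[Q QP] : forall j : K, exists Q, j \in map k Q /\ forall i : th1,
    exists2 V, exists2 z, z \in V & h z = i & above m x c (V ++ Q).
  by move=> j; have [Q jQ H] := HQ j; exists Q.
have /choice[V VP] : forall p : K * th1, exists V,
    (exists2 z, z \in V & h z = p.2) /\ above m x c (V ++ Q p.1).
  by move=> [j i]; have [V zV aV] := (QP j).2 i; exists V.
pose l kk i := top h (V (kk, i)) ++ Q kk.
(* [D kk] holds the length of the cut upper part, a bound for [rho] on its tags, and a bound for
   those tags that do not exceed [v]. *)
have /choice[D DP] : forall kk : K, exists p : nat * th0 * K, forall (v : K) (i0 : th1),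
    exists i, [/\ i0 < i, size (map k (l kk i)) = p.1.1,
      {in map k (l kk i) &, forall y y', y < y' -> rho y y' <= p.1.2} &
      {in map k (l kk i), forall y, y <= p.2 \/ v < y}].
  move=> kk; have [|q [n [b H]]] := @left_stable th0 th1 _ K rho (fun i => map k (l kk i)) reg0 reg1 lt01.
    by exists kk.
  by exists (q, n, b).
have [||[q n] qnP] := @pigeon _ K setT (nat * th0)%type (fun kk p => (D kk).1 = p).
- move=> f _; have [|b bP] := @succ_bound th0 reg0 _ K segK bigK _ setT f.
    apply: card_le_trans (sqr_card_le reg0.1).
    have [t0 _] := reg_inhabited reg0.
    have [r [_ rI]] := card_le_fun t0 reg0.1.
    apply/card_leE; exists (fun p p' => p' = (r p.1, p.2)).
    split=> [p _|[p p'] [s s'] _ _ _ -> [E ->]]; first by exists (r p.1, p.2).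
    by congr pair; exact: rI.
  by exists b => // p; apply/ltW; exact: bP.
- by move=> kk _; exists kk; split=> //; exists (D kk).1.
have /choice[P PP] : forall j : K, exists p, cofS th0 K j ->
    forall c, c < x -> below_at x j p c.
  move=> j; have [Sj|N] := pselect (cofS th0 K j).
    by have [p pP] := low x Sx xF j Sj; exists p.
  have [t0 _] := reg_inhabited reg0; have [t1 _] := reg_inhabited reg1.
  by exists (t1, j, j, t0).
have uj j : cofS th0 K j -> (P j).1.1.2 < j.
  by move=> Sj; have [a [_ uj _]] := PP j Sj c cx.
(* Among the [j] labelled [q], Fodor's lemma makes the bound on the lower tags less than [j] a
   constant [u]. *)
have [|u su] := @stat_fix th0 _ K reg0 segK bigK _ (fun j u => (P j).1.1.2 = u) (lstat q).
  by move=> j [Sj _]; exists (P j).1.1.2 => //; exact: uj.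
have [||f sf] := stat_union reg0 segK bigK (B := fun f => [set j | (P j).2 = f]) su.
- exact: card_lexx.
- by move=> j _; exists (P j).2.
pose Kc := [set kk | (D kk).1 = (q, n) /\ u <= kk].
have Kbig : ~ (Kc #<= [set: th0]).
  move=> /(succ_bound_set reg0 segK bigK)[b bP].
  have [kk [_]] := qnP (Order.max b u) Logic.I; rewrite ge_max => /andP[bk uk] Dk.
  have : kk < b by apply: bP.
  by rewrite ltNge bk.
have Kge : [set: th0] #<= Kc.
  apply: contrapT => /card_cmp[t Ht]; apply: Kbig; apply: card_le_trans Ht _.
  exact: card_leT.
have [phi [phiK phiI]] := card_le_fun u Kge.
have [j0 j0P] := succ_bound reg0 segK bigK phi (card_lexx [set: th0]).
have [j [[[[Sj lj] _ Pu] Pf] j0j jF]] := sf (fun kk => (D kk).2) j0.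
(* There are [th0] candidates below [j], fewer than [th0] of which have [rho] against [j] at most
   [Order.max n f]. *)
have [kk [Dk uk kj rk]] : exists kk, [/\ (D kk).1 = (q, n), u <= kk, kk < j &
    Order.max n f < rho kk j].
  apply: contrapT => N; apply: (@rho_small j (Order.max n f)).
  apply/card_leE; exists (fun t y => phi t = y); split; last first.
    by move=> t t' y _ _ <- E; apply: phiI.
  move=> t _; exists (phi t) => //; have phij : phi t < j by apply: lt_trans (j0P t _) j0j.
  split=> //; rewrite leNgt; apply/negP => H; apply: N.
  by have [? ?] := phiK t Logic.I; exists (phi t).
have [hq hqP] := reg_seq_bound reg1 (Q kk) h.
(* Take [i] beyond all [h]-tags outside [V]. Upper [k]-tags above the bound in [D kk] then exceed
   all lower ones; the others are less than [j] by the closure property [jF]. *)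
have := DP kk (P j).1.2 (Order.max (Order.max m hq) (P j).1.1.1).
rewrite Dk /= => -[i []]; rewrite !gt_max => /andP[/andP[mi hqi] hbi] sz ln lb.
have [[z zV hz] [a1 [u1 [xa1 xz1 u1h u1w]]]] := VP (kk, i).
have [a0 [a0x _ a0P]] := PP j Sj c cx.
exists a0, a1; split=> [|i0 i1]; first exact: lt_trans xa1.
have [cz zx [jw wh wu wv wf]] := a0P i0.
set a := z0 (a0, i0) in cz zx jw wh wu wv wf *; set b := z1 (a1, i1).
split; first exact: lt_trans zx (xz1 i1).
rewrite /colour; have -> : top h (walk a b) = l kk i ++ walk a x.
  rewrite u1w // /l -!catA; apply: (@top_cat _ _ _ _ h i).
  - by move=> y /u1h yh; exact: lt_trans mi.
  - move=> y; rewrite mem_cat => /orP[/hqP yh|/wh yh]; first exact: lt_trans hqi.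
    exact: lt_trans hbi.
  - by exists z => //; rewrite hz.
have -> : dec rho label (map k (l kk i ++ walk a x)) = q.
  rewrite map_cat -lj; move: rk; rewrite gt_max => /andP[nr fr].
  apply: (@dec_cat _ _ _ rho label rho_sub1 rho_sub2 _ _ kk j u n f) => //.
  - by rewrite map_cat mem_cat (QP kk).1 orbT.
  - move=> y yl; have [yb|vy] := lb y yl; [left|right].
      by apply: le_lt_trans yb _; exact: jF.
    by move=> y' y'w; apply: lt_trans vy; exact: wv.
  - by move=> y y' yw y'w yy'; rewrite -Pf; exact: wf.
  - by move=> y yw yj; rewrite -Pu; exact: wu.
(* Skipping the [q] entries of [l kk i] leads to the first node of the walk from [x], which is
   [x]. *)
rewrite nth_cat -{1}(size_map k) sz ltnn.
by rewrite -{1}sz size_map subnn walk_cons.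
Qed.

End Verify.

(** * Assembling the parameters *)

Lemma stat_comp d (T : orderType d) (U : Type) (A : set T) (p : T -> T) (f : T -> U) :
  (forall v, stat [set x | A x /\ p x = v]) -> (forall u, exists v, f v = u) ->
  forall u, stat [set x | A x /\ f (p x) = u].
Proof.
move=> sp fs u; have [v fv] := fs u; apply: stat_sub (sp v) => x [Ax px].
by split; rewrite ?px.
Qed.

Lemma set2_lt_inj d (T : orderType d) (x y x' y' : T) : x < y -> x' < y' ->
  [set x; y] = [set x'; y'] -> x = x' /\ y = y'.
Proof.
move=> xy xy' E.
have [xE|xE] : [set x'; y'] x by rewrite -E; left.
  split=> //; have [yE|//] : [set x'; y'] y by rewrite -E; right.
  by move: xy; rewrite xE yE ltxx.
have [yE|yE] : [set x'; y'] y by rewrite -E; right.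
  by move: xy; rewrite xE yE => /(lt_trans xy'); rewrite ltxx.
by move: xy; rewrite xE yE ltxx.
Qed.

Theorem theorem2p5 (del th0 th1 lam : cardinal) :
  regular del -> regular th0 -> regular th1 ->
  clt th1 del -> clt th0 th1 -> aleph0_le th0 ->
  is_succ_card del lam ->
  Pr1 lam lam lam th0 th1.
Proof.
move=> regD reg0 reg1 lt1D lt01 _ sc.
have segL := succ_card_seg sc; have bigL : ~ ([set: lam] #<= [set: del]) := sc.1.2.
have woL := card_wo (c := lam).
have woK := @succ_in_wo th0 th1; have segK := @succ_in_seg th0 th1.
have bigK := succ_in_big lt01.
have [t1 _] := reg_inhabited reg1.
have [w0 _] := succ_inhabited bigL; have [k0 _] := succ_inhabited bigK.
have [e eI] := succ_inj regD segL; have [eK eKI] := succ_inj reg0 segK.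
have [rho [rho1 rho2 rho3]] := subadditive reg0 woK eKI.
have [p pP] := ulam regD woL segL bigL (stat_cofS regD woL segL bigL).
have [pK pKP] := ulam reg0 woK segK bigK (stat_cofS reg0 woK segK bigK).
have le1L : [set: th1] #<= [set: lam] := card_le_trans lt1D.1 sc.1.1.
have leKL : [set: succ_in th0 th1] #<= [set: lam].
  exact: card_le_trans (@succ_in_le th0 th1) le1L.
have leNK : [set: nat] #<= [set: succ_in th0 th1].
  apply: card_le_trans reg0.1 _; apply: contrapT => /card_cmp[m H]; apply: bigK.
  by apply: card_le_trans H _; exact: card_leT.
have [fh fhP] := card_le_surj t1 le1L.
have [fk fkP] := card_le_surj k0 leKL.
have [fl flP] := card_le_surj 0%N leNK.
(* One partition [p] yields the tags [h], [k] and [g]: each by itself has to take every value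
   stationarily often. *)
pose col := colour e rho (fh \o p) (fk \o p) p (fl \o pK).
(* An unordered pair is coloured through its unique increasing enumeration. *)
exists (fun A => pickd w0 (fun c => exists x y,
  [/\ x < y, sval A = [set x; y] & c = col x y])).
move=> b0 b1 z0 z1 z0I z1I disj gam.
have [a0 [a1 [a01 H]]] := @colour_rectangle del th0 th1 lam regD reg0 reg1 lt1D lt01
  segL bigL e eI rho rho1 rho2 rho3 (fh \o p) (fk \o p) p (fl \o pK)
  (stat_comp pP fhP) (stat_comp pP fkP) pP (stat_comp pKP flP)
  (below b0) (below b1) (@small_below th0 b0) (@small_below th1 b1) z0 z1 z0I z1I gam.
exists a0, a1; split=> // i0 i1; have [lt01z <-] := H i0 i1.
set Q := fun c => _; have [x [y [xy E ->]]] : Q (pickd w0 Q).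
  apply: pickdP; exists (col (z0 (a0, i0)) (z1 (a1, i1))).
  by exists (z0 (a0, i0)), (z1 (a1, i1)).
by have [<- <-] := set2_lt_inj lt01z xy E.
Qed.
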